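(* A compact Riemannian submanifold $\iota:(M^m,g)\to(N^n,h)$ of a Riemannian manifold is $H$-tensional if and only if it is minimal.
   Context: Manifolds are smooth and without boundary. A Riemannian submanifold $\iota:(M^m,g)\to(N^n,h)$ is a (connected) manifold $M$ together with an isometric immersion $\iota$. Its mean curvature vector is $H=\frac1m\operatorname{Tr}_g B=\frac1m\tau(\iota)$, where $B$ is the second fundamental form and $\tau(\iota)=\sum_{i=1}^m\{\nabla^\iota_{e_i}d\iota(e_i)-d\iota(\nabla_{e_i}e_i)\}$ is the tension field ($\{e_i\}$ a local orthonormal frame of $(M,g)$, $\nabla$ the Levi-Civita connection of $(M,g)$, $\nabla^\iota$ the connection on $\iota^{-1}TN$ induced by the Levi-Civita connection of $(N,h)$). $M$ is minimal if $H=0$. The rough Laplacian on sections $\xi$ of $\iota^{-1}TN$ is $\Delta^\iota\xi=-\sum_{i=1}^m(\nabla^\iota_{e_i}\nabla^\iota_{e_i}\xi-\nabla^\iota_{\nabla_{e_i}e_i}\xi)$. $M$ is called $H$-tensional if $\Delta^\iota\tau(\iota)=0$. *)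

(* Defs.v *)
From HB Require Import structures.
From mathcomp Require Import all_boot all_order all_algebra.
From mathcomp Require Import all_classical all_reals all_analysis.
From mathcomp Require Import ring.

Set Implicit Arguments.
Unset Strict Implicit.
Unset Printing Implicit Defensive.

Import Order.TTheory GRing.Theory Num.Theory.
Import numFieldNormedType.Exports.

Local Open Scope classical_set_scope.
Local Open Scope ring_scope.

(* For open [U]; in finite dimension the differential of f is of class C^k iff all the
   directional derivatives of f are. *)
Fixpoint class_C (R : realType) (V W : normedModType R) (k : nat)
    (U : set V) (f : V -> W) : Prop :=
  match k with
  | 0 => forall x, U x -> {for x, continuous f}
  | k'.+1 => (forall x, U x -> differentiable f x) /\
             (forall v, class_C k' U (fun x => 'D_v f x))
  end.

Definition smooth_on (R : realType) (V W : normedModType R)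
  (U : set V) (f : V -> W) : Prop := forall k, class_C k U f.

(* The atlas is not required to be maximal. The values of [chart i] outside
   [chart_dom i], and of [chart_inv i] outside [chart i @` chart_dom i], are
   irrelevant. *)
Record smooth_atlas (R : realType) (n : nat) (M : topologicalType) := SmoothAtlas {
  chart_index : Type;
  chart_dom : chart_index -> set M;
  chart : chart_index -> M -> 'rV[R]_n;
  chart_inv : chart_index -> 'rV[R]_n -> M;
  chart_dom_open : forall i, open (chart_dom i);
  chart_codom_open : forall i, open (chart i @` chart_dom i);
  chartK : forall i p, chart_dom i p -> chart_inv i (chart i p) = p;
  chart_continuous : forall i, {within chart_dom i, continuous (chart i)};
  chart_inv_continuous :
    forall i, {within chart i @` chart_dom i, continuous (chart_inv i)};
  chart_cover : forall p, exists i, chart_dom i p;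
  transition_smooth : forall i j,
    smooth_on (chart i @` (chart_dom i `&` chart_dom j))
              (chart j \o chart_inv i)
}.

Record manifold (R : realType) (n : nat) := Manifold {
  carrier :> topologicalType;
  manifold_hausdorff : hausdorff_space carrier;
  manifold_second_countable : @second_countable carrier;
  atlas : smooth_atlas R n carrier
}.

Section Charts.
Variables (R : realType) (n : nat) (M : manifold R n).

Definition charts : Type := chart_index (atlas M).
Definition dom (i : charts) : set M := chart_dom i.
Definition coord (i : charts) : M -> 'rV[R]_n := chart i.
Definition param (i : charts) : 'rV[R]_n -> M := chart_inv i.
Definition chart_codom (i : charts) : set 'rV[R]_n := coord i @` dom i.
Definition transition (i j : charts) : 'rV[R]_n -> 'rV[R]_n :=
  coord j \o param i.

End Charts.

Definition bilin (R : realType) (n : nat) (A : 'M[R]_n) (u v : 'rV[R]_n) : R :=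
  (u *m A *m v^T) 0 0.

(* [gram g i x] is the matrix (g_ab) of the metric in the chart [i], at the
   point with coordinates [x]; [metric_compat] says that these matrices are
   the expressions of one tensor field on the manifold. *)
Record riemannian_metric (R : realType) (n : nat) (M : manifold R n) :=
    RiemannianMetric {
  gram : charts M -> 'rV[R]_n -> 'M[R]_n;
  gram_smooth : forall i, smooth_on (chart_codom i) (gram i);
  gram_sym : forall i x, chart_codom i x -> (gram i x)^T = gram i x;
  gram_posdef : forall i x, chart_codom i x ->
    forall u, u != 0 -> 0 < bilin (gram i x) u u;
  metric_compat : forall i j p, dom i p -> dom j p -> forall u v,
    bilin (gram i (coord i p)) u v =
    bilin (gram j (coord j p)) ('D_u (transition i j) (coord i p))
                               ('D_v (transition i j) (coord i p))
}.

Section Connections.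
Variable R : realType.

Definition basis_vector (n : nat) (i : 'I_n) : 'rV[R]_n := delta_mx 0 i.

(* Gamma^k_{ij} for the metric with matrix field [G] *)
Definition christoffel (n : nat) (G : 'rV[R]_n -> 'M[R]_n) (x : 'rV[R]_n)
    (k i j : 'I_n) : R :=
  2^-1 * \sum_(l < n) invmx (G x) k l *
    ('D_(basis_vector i) (fun y => G y j l) x
     + 'D_(basis_vector j) (fun y => G y i l) x
     - 'D_(basis_vector l) (fun y => G y i j) x).

Definition christoffel_form (n : nat) (G : 'rV[R]_n -> 'M[R]_n)
    (x u v : 'rV[R]_n) : 'rV[R]_n :=
  \row_k \sum_(i < n) \sum_(j < n) christoffel G x k i j * u 0 i * v 0 j.

(* the Levi-Civita connection of [G]; see [nabla_torsion_free] and
   [nabla_metric] *)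
Definition nabla (n : nat) (G : 'rV[R]_n -> 'M[R]_n)
    (X Y : 'rV[R]_n -> 'rV[R]_n) : 'rV[R]_n -> 'rV[R]_n :=
  fun x => 'D_(X x) Y x + christoffel_form G x (X x) (Y x).

Definition push (m n : nat) (f : 'rV[R]_m -> 'rV[R]_n)
    (X : 'rV[R]_m -> 'rV[R]_m) : 'rV[R]_m -> 'rV[R]_n :=
  fun x => 'D_(X x) f x.

(* the connection induced on the pull-back of the tangent bundle by [f] from
   the Levi-Civita connection of [K]; see [nabla_pullback_comp] *)
Definition nabla_pullback (m n : nat) (K : 'rV[R]_n -> 'M[R]_n)
    (f : 'rV[R]_m -> 'rV[R]_n) (X : 'rV[R]_m -> 'rV[R]_m)
    (xi : 'rV[R]_m -> 'rV[R]_n) : 'rV[R]_m -> 'rV[R]_n :=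
  fun x => 'D_(X x) xi x + christoffel_form K (f x) (push f X x) (xi x).

Lemma nabla_pullback_comp (m n : nat) (K : 'rV[R]_n -> 'M[R]_n)
    (f : 'rV[R]_m -> 'rV[R]_n) (X : 'rV[R]_m -> 'rV[R]_m)
    (Y Z : 'rV[R]_n -> 'rV[R]_n) (x : 'rV[R]_m) :
  differentiable f x -> differentiable Y (f x) -> Z (f x) = push f X x ->
  nabla_pullback K f X (Y \o f) x = nabla K Z Y (f x).
Proof.
move=> df dY ZX; rewrite /nabla_pullback /nabla ZX; congr (_ + _).
rewrite /push deriveE; last exact: differentiable_comp.
by rewrite diff_comp //= -!deriveE.
Qed.

Lemma christoffel_sym (n : nat) (G : 'rV[R]_n -> 'M[R]_n) (x : 'rV[R]_n)
    (k i j : 'I_n) :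
  (\near x, (G x)^T = G x) -> christoffel G x k i j = christoffel G x k j i.
Proof.
move=> symG; rewrite /christoffel; congr (_ * _).
apply: eq_bigr => l _; congr (_ * (_ - _)); first by rewrite addrC.
apply: near_eq_derive; move: symG; apply: filterS => y /matrixP/(_ j i).
by rewrite mxE.
Qed.

Lemma nabla_torsion_free (n : nat) (G : 'rV[R]_n -> 'M[R]_n)
    (X Y : 'rV[R]_n -> 'rV[R]_n) (x : 'rV[R]_n) :
  (\near x, (G x)^T = G x) ->
  nabla G X Y x - nabla G Y X x = 'D_(X x) Y x - 'D_(Y x) X x.
Proof.
move=> symG.
suff E : christoffel_form G x (X x) (Y x) = christoffel_form G x (Y x) (X x).
  by rewrite /nabla opprD addrACA E subrr addr0.
apply/rowP => k; rewrite !mxE exchange_big /=; apply: eq_bigr => i _.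
apply: eq_bigr => j _; rewrite christoffel_sym //.
by rewrite mulrAC.
Qed.

Lemma bilinE (n : nat) (A : 'M[R]_n) (u v : 'rV[R]_n) :
  bilin A u v = \sum_(i < n) \sum_(j < n) A i j * u 0 i * v 0 j.
Proof.
rewrite /bilin mxE exchange_big; apply: eq_bigr => j _.
by rewrite !mxE mulr_suml; apply: eq_bigr => i _; rewrite [A i j * _]mulrC.
Qed.

Lemma christoffel_lower (n : nat) (G : 'rV[R]_n -> 'M[R]_n) (x : 'rV[R]_n)
    (i j l : 'I_n) : G x \in unitmx ->
  \sum_(k < n) G x l k * christoffel G x k i j =
  2^-1 * ('D_(basis_vector i) (fun y => G y j l) x
     + 'D_(basis_vector j) (fun y => G y i l) x
     - 'D_(basis_vector l) (fun y => G y i j) x).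
Proof.
move=> uG; pose c : 'cV[R]_n := \col_l
  ('D_(basis_vector i) (fun y => G y j l) x
     + 'D_(basis_vector j) (fun y => G y i l) x
     - 'D_(basis_vector l) (fun y => G y i j) x).
have -> : \sum_(k < n) G x l k * christoffel G x k i j =
    2^-1 * (G x *m (invmx (G x) *m c)) l 0.
  rewrite mxE mulr_sumr; apply: eq_bigr => k _.
  rewrite /christoffel mulrCA; congr (_ * (_ * _)).
  by rewrite mxE; apply: eq_bigr => l' _; rewrite mxE.
by rewrite mulmxA mulmxV // mul1mx mxE.
Qed.

Lemma christoffel_metric (n : nat) (G : 'rV[R]_n -> 'M[R]_n) (x : 'rV[R]_n)
    (c a b : 'I_n) :
  (\near x, (G x)^T = G x) -> G x \in unitmx ->
  'D_(basis_vector c) (fun y => G y a b) x =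
  \sum_(k < n) christoffel G x k c a * G x k b +
  \sum_(k < n) christoffel G x k c b * G x a k.
Proof.
move=> symG uG.
have sG (v : 'rV[R]_n) i j :
    'D_v (fun y => G y i j) x = 'D_v (fun y => G y j i) x.
  apply: near_eq_derive; move: symG; apply: filterS => y /matrixP/(_ i j) <-.
  by rewrite mxE.
have sGx i j : G x i j = G x j i.
  by have /matrixP/(_ j i) <- := nbhs_singleton symG; rewrite mxE.
rewrite (eq_bigr (fun k => G x b k * christoffel G x k c a)); last first.
  by move=> k _; rewrite mulrC sGx.
rewrite [X in _ + X](eq_bigr (fun k => G x a k * christoffel G x k c b));
  last by move=> k _; rewrite mulrC.
rewrite !christoffel_lower // (sG _ b a) (sG _ c a) (sG _ c b).
by field.
Qed.

Lemma nabla_metric (n : nat) (G : 'rV[R]_n -> 'M[R]_n)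
    (X Y Z : 'rV[R]_n -> 'rV[R]_n) (x : 'rV[R]_n) :
  (\near x, (G x)^T = G x) -> G x \in unitmx ->
  differentiable G x -> differentiable Y x -> differentiable Z x ->
  'D_(X x) (fun y => bilin (G y) (Y y) (Z y)) x =
  bilin (G x) (nabla G X Y x) (Z x) + bilin (G x) (Y x) (nabla G X Z x).
Proof.
move=> symG uG dG dY dZ; set v := X x.
have DG : derivable G x v by exact: diff_derivable.
have DY : derivable Y x v by exact: diff_derivable.
have DZ : derivable Z x v by exact: diff_derivable.
have DGe i j : derivable (fun y => G y i j) x v.
  exact: (derivable_mxP G x v).1.
have DYe i j : derivable (fun y => Y y i j) x v.
  exact: (derivable_mxP Y x v).1.
have DZe i j : derivable (fun y => Z y i j) x v.
  exact: (derivable_mxP Z x v).1.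
have dGe i j : 'D_v (fun y => G y i j) x =
    \sum_(c < n) v 0 c * 'D_(basis_vector c) (fun y => G y i j) x.
  have dGij : differentiable (fun y => G y i j) x.
    exact: (differentiable_comp dG (differentiable_coord _ _ _)).
  rewrite {1}[v]row_sum_delta deriveE // linear_sum; apply: eq_bigr => c _.
  by rewrite linearZ /= deriveE.
have Dt i j : is_derive x v (fun y => G y i j * Y y 0 i * Z y 0 j)
    (G x i j * Y x 0 i * 'D_v (fun y => Z y 0 j) x +
     Z x 0 j * (G x i j * 'D_v (fun y => Y y 0 i) x +
                Y x 0 i * 'D_v (fun y => G y i j) x)).
  apply: is_deriveM; last exact: derivableP.
  by apply: is_deriveM; exact: derivableP.
have Ds : 'D_v (fun y => bilin (G y) (Y y) (Z y)) x =
   \sum_(i < n) \sum_(j < n)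
   (G x i j * Y x 0 i * 'D_v (fun y => Z y 0 j) x +
     Z x 0 j * (G x i j * 'D_v (fun y => Y y 0 i) x +
                Y x 0 i * 'D_v (fun y => G y i j) x)).
  have -> : (fun y => bilin (G y) (Y y) (Z y)) =
     \sum_(i < n) \sum_(j < n) (fun y => G y i j * Y y 0 i * Z y 0 j).
    apply/funext => y; rewrite bilinE fct_sumE; apply: eq_bigr => i _.
    by rewrite fct_sumE.
  exact: derive_val.
rewrite Ds !bilinE -big_split /=.
pose gam := christoffel G x.
pose T1 := \sum_(a < n) \sum_(b < n) \sum_(c < n) \sum_(k < n)
  gam k c a * G x k b * v 0 c * Y x 0 a * Z x 0 b.
pose T2 := \sum_(a < n) \sum_(b < n) \sum_(c < n) \sum_(k < n)
  gam k c b * G x a k * v 0 c * Y x 0 a * Z x 0 b.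
pose T0 := \sum_(i < n) \sum_(j < n)
   (G x i j * Y x 0 i * 'D_v (fun y => Z y 0 j) x +
     Z x 0 j * (G x i j * 'D_v (fun y => Y y 0 i) x)).
transitivity (T0 + (T1 + T2)).
  rewrite /T0 /T1 /T2 -!big_split; apply: eq_bigr => i _ /=.
  rewrite -!big_split; apply: eq_bigr => j _ /=.
  rewrite mulrDr [LHS]addrA; congr (_ + _).
  rewrite dGe mulr_sumr mulr_sumr -big_split; apply: eq_bigr => c _ /=.
  rewrite christoffel_metric // -/gam !mulrDr; congr (_ + _);
    rewrite !mulr_sumr; apply: eq_bigr => k _; ring.
have E1 : T1 = \sum_(i < n) \sum_(j < n)
    G x i j * christoffel_form G x v (Y x) 0 i * Z x 0 j.
  rewrite /T1.
  rewrite [RHS](eq_bigr (fun i => \sum_(b < n) \sum_(a < n) \sum_(c < n)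
    gam i c a * G x i b * v 0 c * Y x 0 a * Z x 0 b)); last first.
    move=> i _; apply: eq_bigr => b _.
    rewrite mxE exchange_big mulr_sumr mulr_suml; apply: eq_bigr => a _.
    rewrite mulr_sumr mulr_suml; apply: eq_bigr => c _; rewrite /gam; ring.
  rewrite [RHS]exchange_big /= [LHS]exchange_big /=; apply: eq_bigr => b _.
  rewrite [RHS]exchange_big /=; apply: eq_bigr => a _.
  by rewrite [RHS]exchange_big.
have E2 : T2 = \sum_(i < n) \sum_(j < n)
    G x i j * Y x 0 i * christoffel_form G x v (Z x) 0 j.
  rewrite /T2; apply: eq_bigr => a _.
  rewrite [RHS](eq_bigr (fun k => \sum_(b < n) \sum_(c < n)
    gam k c b * G x a k * v 0 c * Y x 0 a * Z x 0 b)); last first.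
    move=> k _; rewrite mxE exchange_big mulr_sumr; apply: eq_bigr => b _.
    rewrite mulr_sumr; apply: eq_bigr => c _; rewrite /gam; ring.
  rewrite [RHS]exchange_big /=; apply: eq_bigr => b _.
  by rewrite [RHS]exchange_big.
rewrite E1 E2 /T0 -!big_split; apply: eq_bigr => i _ /=.
rewrite -!big_split; apply: eq_bigr => j _ /=.
rewrite /nabla -/v !mxE (derive_mx DY) (derive_mx DZ) !mxE; ring.
Qed.

End Connections.

Section Submanifolds.
Variables (R : realType) (m n : nat) (M : manifold R m) (N : manifold R n).
Variables (g : riemannian_metric M) (h : riemannian_metric N) (iota : M -> N).

Definition local_dom (i : charts M) (j : charts N) : set 'rV[R]_m :=
  coord i @` (dom i `&` iota @^-1` dom j).

Definition local_rep (i : charts M) (j : charts N) : 'rV[R]_m -> 'rV[R]_n :=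
  coord j \o iota \o param i.

Definition smooth_map : Prop :=
  continuous iota /\
  forall i j, smooth_on (local_dom i j) (local_rep i j).

Definition immersion : Prop :=
  smooth_map /\
  forall i j x, local_dom i j x ->
    forall u, 'D_u (local_rep i j) x = 0 -> u = 0.

Definition isometric_immersion : Prop :=
  immersion /\
  forall i j x, local_dom i j x -> forall u v,
    bilin (gram g i x) u v =
    bilin (gram h j (local_rep i j x)) ('D_u (local_rep i j) x)
                                       ('D_v (local_rep i j) x).

(* a local orthonormal frame of [M] on the open set with image [U] in the
   chart [i], small enough to be mapped by [iota] into the chart [j] *)
Definition orthonormal_frame (i : charts M) (j : charts N)
    (U : set 'rV[R]_m) (e : 'I_m -> 'rV[R]_m -> 'rV[R]_m) : Prop :=
  [/\ open U, U `<=` local_dom i j, (forall a, smooth_on U (e a)) &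
      forall x, U x -> forall a b,
        bilin (gram g i x) (e a x) (e b x) = (a == b)%:R].

Section InCharts.
Variables (i : charts M) (j : charts N) (e : 'I_m -> 'rV[R]_m -> 'rV[R]_m).

Let D := nabla (gram g i).
Let Diota := nabla_pullback (gram h j) (local_rep i j).
Let diota := push (local_rep i j).

Definition second_fundamental_form (X Y : 'rV[R]_m -> 'rV[R]_m) :
    'rV[R]_m -> 'rV[R]_n :=
  fun x => Diota X (diota Y) x - diota (D X Y) x.

Definition mean_curvature : 'rV[R]_m -> 'rV[R]_n :=
  fun x => m%:R^-1 *: \sum_(a < m) second_fundamental_form (e a) (e a) x.

Definition tension : 'rV[R]_m -> 'rV[R]_n :=
  fun x => \sum_(a < m) (Diota (e a) (diota (e a)) x - diota (D (e a) (e a)) x).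

Definition rough_laplacian (xi : 'rV[R]_m -> 'rV[R]_n) :
    'rV[R]_m -> 'rV[R]_n :=
  fun x => - \sum_(a < m)
    (Diota (e a) (Diota (e a) xi) x - Diota (D (e a) (e a)) xi x).

End InCharts.

(* All these expressions are independent of the charts and of the frame, and
   every point of [M] has a neighbourhood carrying such a frame. *)
Definition minimal : Prop :=
  forall i j U e, orthonormal_frame i j U e ->
  forall x, U x -> mean_curvature i j e x = 0.

Definition H_tensional : Prop :=
  forall i j U e, orthonormal_frame i j U e ->
  forall x, U x -> rough_laplacian i j e (tension i j e) x = 0.

End Submanifolds.

(* Main.v *)
From HB Require Import structures.
From mathcomp Require Import all_boot all_order all_algebra.
From mathcomp Require Import all_classical all_reals all_analysis.
From mathcomp Require Import ring.
Require Import Defs.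

Set Implicit Arguments.
Unset Strict Implicit.
Unset Printing Implicit Defensive.

Import Order.TTheory GRing.Theory Num.Theory.
Import numFieldNormedType.Exports.

Local Open Scope classical_set_scope.
Local Open Scope ring_scope.

(** Write tau for the tension field and nabla for the induced connection on the
    pulled back tangent bundle. A minimal submanifold has tau = 0, hence it is
    H-tensional.

    Conversely, let tau be in the kernel of the rough Laplacian. The function
    |tau|^2 is globally defined on the compact manifold M, so it has a maximum
    at some point p. There its gradient vanishes and its second derivatives
    are nonpositive. Summing over an orthonormal frame, and using that the
    Laplacian term of the Bochner formula

      1/2 sum_a (e_a e_a - nabla_{e_a} e_a) |tau|^2
        = - <Delta tau, tau> + sum_a |nabla_{e_a} tau|^2

    is zero, one finds that nabla tau vanishes at p ([energy_bochner]). Now tau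
    is normal to the submanifold, as a trace of the second fundamental form
    ([sff_normal]). Differentiating <tau, df(e_a)> = 0 at p along e_a, and
    summing, gives |tau|^2 = - sum_a <nabla_{e_a} tau, df(e_a)> = 0 at p
    ([parallel_tension_eq0]). The maximum of |tau|^2 is thus 0, and tau = 0
    everywhere.

    Two facts make this work in charts. Every metric has local orthonormal
    frames, by a Gram-Schmidt process that preserves smoothness
    ([gram_schmidt]); they also express the inverse metric, so that Christoffel
    symbols are smooth. And |tau|^2 is independent of the charts and of the
    frame ([energy_indep]). The latter comes again from normality: a change of
    charts is an isometric immersion between spaces of equal dimension, so its
    second fundamental form is normal to the whole space, hence zero
    ([sff_eq_dim]), and the second fundamental form of a composition
    ([sff_comp]) then shows that tau transforms as a tangent vector of N. *)

(** * Functions of class C^k on an open set *)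

Lemma class_C_subset (R : realType) (V W : normedModType R) k (U U' : set V)
    (f : V -> W) : U' `<=` U -> class_C k U f -> class_C k U' f.
Proof.
move=> U'U; elim: k f => [|k IH] f /=; first by move=> cf x /U'U; exact: cf.
by move=> [df cf]; split=> [x /U'U|v]; [exact: df|exact/IH/cf].
Qed.

Lemma near_preimage (T T' : topologicalType) (f : T -> T') (U' : set T') x :
  {for x, continuous f} -> open U' -> U' (f x) -> \forall y \near x, U' (f y).
Proof. by move=> cf oU' U'x; apply: (cf U'); exact: open_nbhs_nbhs. Qed.

Section ClassC.
Variables (R : realType) (V : normedModType R) (U : set V).
Hypothesis U_open : open U.

Lemma open_near (x : V) : U x -> \near x, U x.
Proof. by move=> Ux; exact: open_nbhs_nbhs. Qed.

Lemma derive_eq_on (W : normedModType R) (f g : V -> W) v :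
  (forall x, U x -> f x = g x) -> forall x, U x -> 'D_v f x = 'D_v g x.
Proof.
move=> fg x Ux; apply: near_eq_derive.
by apply: filterS (open_near Ux) => y; exact: fg.
Qed.

Lemma near_eq_differentiable (W : normedModType R) (f g : V -> W) x :
  (\near x, f x = g x) -> differentiable f x -> differentiable g x.
Proof.
move=> fg /diff_locallyP [dc df].
have g_expansion : g \o shift x = cst (g x) + 'd f x +o_ 0 id.
  rewrite -(nbhs_singleton fg); apply/eqaddoP => e e0.
  move/eqaddoP : df => /(_ e e0); rewrite -!nbhs_nearE /= => f_small.
  have fg0 : \forall z \near 0, f (z + x) = g (z + x).
    by move: fg; rewrite (near_shift 0 x) /=; apply: filterS => z; rewrite /= subr0.
  by apply: filterS2 f_small fg0 => z + fgz; rewrite !fctE /= fgz.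
apply/diff_locallyP.
by have -> : 'd g x = 'd f x :> (V -> W) by exact: diff_unique.
Qed.

Lemma class_C_eq (W : normedModType R) k (f g : V -> W) :
  (forall x, U x -> f x = g x) -> class_C k U f -> class_C k U g.
Proof.
elim: k f g => [|k IH] f g fg /= => [cf x Ux|[df cf]].
  have e : \forall y \near x, f y = g y.
    by apply: filterS (open_near Ux) => y; exact: fg.
  rewrite /prop_for /continuous_at -(fg _ Ux).
  apply: cvg_trans (cf x Ux).
  exact: near_eq_cvg.
split=> [x Ux|v].
  apply: near_eq_differentiable (df x Ux).
  by apply: filterS (open_near Ux) => y; exact: fg.
by apply: IH (cf v); exact: derive_eq_on.
Qed.

Lemma class_CW (W : normedModType R) k (f : V -> W) :
  class_C k.+1 U f -> class_C k U f.
Proof.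
elim: k f => [|k IH] f [df cf].
  by move=> x Ux; exact/differentiable_continuous/df.
by split=> // v; exact/IH/cf.
Qed.

Lemma class_C_cst (W : normedModType R) k (w : W) : class_C k U (fun=> w).
Proof.
elim: k w => [|k IH] w /=; first by move=> x _; exact: cvg_cst.
split=> // v.
by apply: class_C_eq (IH 0) => x _; rewrite derive_cst.
Qed.

Lemma class_C_id k : class_C k U id.
Proof.
case: k => [x _|k]; first exact: cvg_id.
split=> [x _|v]; first exact: ex_diff.
by apply: class_C_eq (class_C_cst k v) => x _; rewrite derive_id.
Qed.

Lemma class_CD (W : normedModType R) k (f g : V -> W) :
  class_C k U f -> class_C k U g -> class_C k U (fun x => f x + g x).
Proof.
elim: k f g => [|k IH] f g /=.
  by move=> cf cg x Ux; apply: cvgD; [exact: cf|exact: cg].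
move=> [df cf] [dg cg]; split=> [x Ux|v].
  by apply: differentiableD; [exact: df|exact: dg].
apply: class_C_eq (IH _ _ (cf v) (cg v)) => x Ux.
by rewrite deriveD //; apply: diff_derivable; [exact: df|exact: dg].
Qed.

Lemma class_C_sum (W : normedModType R) (I : Type) (r : seq I) (P : pred I) k
    (f : I -> V -> W) :
  (forall i, P i -> class_C k U (f i)) ->
  class_C k U (fun x => \sum_(i <- r | P i) f i x).
Proof.
move=> cf; elim: r => [|i r IH].
  by apply: class_C_eq (class_C_cst k 0) => x _; rewrite big_nil.
case Pi : (P i).
  by apply: class_C_eq (class_CD (cf i Pi) IH) => x _; rewrite big_cons Pi.
by apply: class_C_eq IH => x _; rewrite big_cons Pi.
Qed.

Lemma class_CM k (f g : V -> R) :
  class_C k U f -> class_C k U g -> class_C k U (fun x => f x * g x).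
Proof.
elim: k f g => [|k IH] f g /=.
  by move=> cf cg x Ux; apply: cvgM; [exact: cf|exact: cg].
move=> [df cf] [dg cg]; split=> [x Ux|v].
  by apply: differentiableM; [exact: df|exact: dg].
have ckf : class_C k U f by exact: class_CW.
have ckg : class_C k U g by exact: class_CW.
apply: class_C_eq (class_CD (IH _ _ ckf (cg v)) (IH _ _ ckg (cf v))) => x Ux.
by rewrite deriveM //; apply: diff_derivable; [exact: df|exact: dg].
Qed.

Lemma class_CZ k (c : R) (f : V -> R) :
  class_C k U f -> class_C k U (fun x => c * f x).
Proof. by move=> cf; apply: class_CM => //; exact: class_C_cst. Qed.

Lemma class_CN k (f : V -> R) :
  class_C k U f -> class_C k U (fun x => - f x).
Proof.
by move=> /(class_CZ (-1)); apply: class_C_eq => x _; rewrite mulN1r.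
Qed.

Lemma class_CV k (f : V -> R) : (forall x, U x -> f x != 0) ->
  class_C k U f -> class_C k U (fun x => (f x)^-1).
Proof.
move=> f0; elim: k => [|k IH] /=.
  by move=> cf x Ux; apply: cvgV; [exact: f0|exact: cf].
move=> [df cf]; split=> [x Ux|v].
  by apply: differentiableV; [exact: df|exact: f0].
have cV : class_C k U (fun x => (f x)^-1) by apply/IH/class_CW.
apply: class_C_eq (class_CM (class_CN (class_CM cV cV)) (cf v)) => x Ux.
have /= -> := deriveV (f0 _ Ux) (diff_derivable (df x Ux)).
by rewrite expr2 invfM.
Qed.

Lemma differentiable_sqrt (f : V -> R) x : 0 < f x -> differentiable f x ->
  differentiable (fun y => Num.sqrt (f y)) x.
Proof.
move=> f0 df; apply: differentiable_comp df _.
by apply/derivable1_diffP; have [] := is_derive1_sqrt f0.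
Qed.

Lemma derive_sqrt (f : V -> R) x v : 0 < f x -> differentiable f x ->
  'D_v (fun y => Num.sqrt (f y)) x = (2 * Num.sqrt (f x))^-1 * 'D_v f x.
Proof.
move=> f0 df; have ds := is_derive1_sqrt f0.
have dfs : differentiable (Num.sqrt : R -> R) (f x).
  by apply/derivable1_diffP; have [] := ds.
rewrite deriveE; last exact: differentiable_sqrt.
rewrite (diff_comp df dfs) /= -(deriveE _ df).
have -> : 'd (Num.sqrt : R -> R) (f x) ('D_v f x) =
   'D_v f x *: 'd (Num.sqrt : R -> R) (f x) 1.
  by rewrite -linearZ /= [_%:A]mulr1.
by rewrite -(deriveE _ dfs) (@derive_val _ _ _ _ _ _ _ ds) [LHS]mulrC.
Qed.

Lemma class_C_sqrt k (f : V -> R) : (forall x, U x -> 0 < f x) ->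
  class_C k U f -> class_C k U (fun x => Num.sqrt (f x)).
Proof.
move=> f0; elim: k => [|k IH] /=.
  move=> cf x Ux; apply: (@continuous_comp _ _ _ f (@Num.sqrt R)) (cf x Ux) _.
  exact: sqrt_continuous.
move=> [df cf]; split=> [x Ux|v].
  by apply: differentiable_sqrt; [exact: f0|exact: df].
have cs : class_C k U (fun x => Num.sqrt (f x)) by apply/IH/class_CW.
have cV : class_C k U (fun x => (2 * Num.sqrt (f x))^-1).
  apply: class_CV (class_CZ 2 cs) => x Ux.
  by rewrite mulf_neq0 // sqrtr_eq0 -ltNge f0.
apply: class_C_eq (class_CM cV (cf v)) => x Ux.
by rewrite derive_sqrt //; [exact: f0|exact: df].
Qed.

Lemma differentiable_mx p q (A : V -> 'M[R]_(p, q)) x :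
  (forall i j, differentiable (fun y => A y i j) x) -> differentiable A x.
Proof.
move=> dA.
have -> : A = \sum_(i < p) \sum_(j < q) (fun y => A y i j *: delta_mx i j).
  apply/funext => y; rewrite [LHS]matrix_sum_delta fct_sumE.
  by apply: eq_bigr => i _; rewrite fct_sumE.
apply: differentiable_sum => i; apply: differentiable_sum => j.
exact: differentiableZl.
Qed.

Lemma differentiable_entry p q (A : V -> 'M[R]_(p, q)) x i j :
  differentiable A x -> differentiable (fun y => A y i j) x.
Proof.
by move=> dA; exact: (differentiable_comp dA (differentiable_coord _ _ _)).
Qed.

Lemma derive_entry p q (A : V -> 'M[R]_(p, q)) x v i j :
  differentiable A x -> ('D_v A x) i j = 'D_v (fun y => A y i j) x.
Proof. by move=> dA; rewrite derive_mx ?mxE //; exact: diff_derivable. Qed.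

(** A matrix-valued function is rebuilt from its entries as a sum of scalar
    functions times constant matrices; this reduces closure properties of
    vector-valued functions to those of scalar ones. *)
Lemma class_C_mxP p q k (A : V -> 'M[R]_(p, q)) :
  class_C k U A <-> forall i j, class_C k U (fun x => A x i j).
Proof.
split.
  elim: k A => [|k IH] A /= => [cA i j x Ux|[dA cA] i j].
    apply: (@continuous_comp _ _ _ A (fun B : 'M[R]_(p, q) => B i j)) (cA x Ux) _.
    exact: coord_continuous.
  split=> [x Ux|v]; first exact/differentiable_entry/dA.
  apply: class_C_eq (IH _ (cA v) i j) => x Ux.
  exact/derive_entry/dA.
elim: k A => [|k IH] A /= cA.
  move=> x Ux.
  have e y : A y = \sum_(i < p) \sum_(j < q) A y i j *: delta_mx i j.
    exact: matrix_sum_delta.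
  rewrite /prop_for /continuous_at (funext e) /=.
  apply: (@cvg_big _ _ _ _ _ add_continuous _ (nbhs x) _
    (fun i y => \sum_(j < q) A y i j *: delta_mx i j)) => i _.
  apply: (@cvg_big _ _ _ _ _ add_continuous _ (nbhs x) _
    (fun j y => A y i j *: delta_mx i j)) => j _.
  by apply: cvgZr_tmp; exact: cA.
have dA x : U x -> differentiable A x.
  by move=> Ux; apply: differentiable_mx => i j; have [+ _] := cA i j; apply.
split=> // v; apply: IH => i j; have [_ /(_ v)] := cA i j.
by apply: class_C_eq => x Ux; rewrite derive_entry //; exact: dA.
Qed.

End ClassC.

(** * Chain rule, second derivatives and local maxima *)

Section ChainRule.
Variable R : realType.

Lemma derive_comp (V V' W : normedModType R) (f : V -> V') (g : V' -> W) x v :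
  differentiable f x -> differentiable g (f x) ->
  'D_v (fun y => g (f y)) x = 'D_('D_v f x) g (f x).
Proof.
move=> df dg; rewrite deriveE; last exact: differentiable_comp.
by rewrite (diff_comp df dg) /= (deriveE _ df) (deriveE _ dg).
Qed.

Lemma derive_dirE (W : normedModType R) n (f : 'rV[R]_n -> W) x v :
  differentiable f x ->
  'D_v f x = \sum_(c < n) v 0 c *: 'D_(basis_vector R c) f x.
Proof.
move=> df; rewrite {1}[v]row_sum_delta deriveE // linear_sum.
by apply: eq_bigr => c _; rewrite linearZ /= deriveE.
Qed.

(** Induction on k, by the chain rule: the derivative of g o f is a sum of
    products of a component of the derivative of f with a composite
    (d_c g) o f, to which the induction hypothesis applies. *)
Lemma class_C_comp (V : normedModType R) n k (U : set V) (U' : set 'rV[R]_n)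
    (f : V -> 'rV[R]_n) (g : 'rV[R]_n -> R) :
  open U -> open U' -> (forall x, U x -> U' (f x)) ->
  class_C k U f -> class_C k U' g -> class_C k U (fun x => g (f x)).
Proof.
move=> oU oU' fU; elim: k g => [|k IH] g.
  move=> cf cg x Ux; apply: (@continuous_comp _ _ _ f g) (cf x Ux) _.
  exact/cg/fU.
move=> cf; have cf' := class_CW cf; have [df dcf] := cf.
move=> [dg dcg]; split=> [x Ux|v].
  by apply: differentiable_comp; [exact: df|exact/dg/fU].
have H : class_C k U (fun x => \sum_(c < n)
    ('D_v f x) 0 c * 'D_(basis_vector R c) g (f x)).
  apply: class_C_sum => // c _; apply: class_CM => //.
    by move/(class_C_mxP oU): (dcf v); apply.
  exact: (IH ('D_(basis_vector R c) g) cf' (dcg _)).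
apply: class_C_eq H => // x Ux.
rewrite (derive_comp _ (df _ Ux) (dg _ (fU _ Ux))).
by rewrite (derive_dirE _ (dg _ (fU _ Ux))).
Qed.

Lemma class_C_derive_along m k (U : set 'rV[R]_m) (X : 'rV[R]_m -> 'rV[R]_m)
    (f : 'rV[R]_m -> R) :
  open U -> class_C k U X -> class_C k.+1 U f ->
  class_C k U (fun x => 'D_(X x) f x).
Proof.
move=> oU cX [df cf].
have H : class_C k U (fun x => \sum_(c < m) X x 0 c * 'D_(basis_vector R c) f x).
  apply: class_C_sum => // c _; apply: class_CM => //.
    by move/(class_C_mxP oU): cX; apply.
  exact: cf.
by apply: class_C_eq H => // x Ux; rewrite (derive_dirE _ (df _ Ux)).
Qed.

Lemma class_C_derive_along_row m n k (U : set 'rV[R]_m)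
    (X : 'rV[R]_m -> 'rV[R]_m) (f : 'rV[R]_m -> 'rV[R]_n) :
  open U -> class_C k U X -> class_C k.+1 U f ->
  class_C k U (fun x => 'D_(X x) f x).
Proof.
move=> oU cX cf; have [df _] := cf; apply/(class_C_mxP oU) => i l.
have cl : class_C k.+1 U (fun y => f y i l) by move/(class_C_mxP oU): cf; apply.
apply: (class_C_eq oU _ (class_C_derive_along oU cX cl)) => x Ux.
by rewrite (derive_entry _ _ _ (df _ Ux)).
Qed.

End ChainRule.

Section SecondDerivatives.
Variables (R : realType) (V : normedModType R).

Lemma differentiable_line (c u : V) (t : R) :
  differentiable (fun s : R => c + s *: u) t.
Proof.
by apply: differentiableD; [exact: differentiable_cst|exact: differentiableZl].
Qed.

Lemma derive_line (c u : V) (t : R) : 'D_1 (fun s : R => c + s *: u) t = u.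
Proof.
rewrite (@deriveD _ _ _ (cst c) (fun s : R => s *: u)); last first.
- exact/diff_derivable/differentiableZl.
- exact: derivable_cst.
rewrite derive_cst add0r deriveE; last exact: differentiableZl.
by rewrite diffZl // diff_val scale1r.
Qed.

Lemma is_derive_along_line (f : V -> R) (c u : V) (t : R) :
  differentiable f (c + t *: u) ->
  is_derive t 1 (fun s : R => f (c + s *: u)) ('D_u f (c + t *: u)).
Proof.
move=> df; have dl := differentiable_line c u t.
apply: DeriveDef; first exact/diff_derivable/differentiable_comp.
by rewrite (derive_comp _ dl df) derive_line.
Qed.

Lemma MVT_line (f : V -> R) (c u : V) (h : R) : 0 < h ->
  (forall t, 0 <= t <= h -> differentiable f (c + t *: u)) ->
  exists2 t, 0 < t < h & f (c + h *: u) - f c = h * 'D_u f (c + t *: u).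
Proof.
move=> h0 df.
have [x xh||t th E] := @MVT R (fun t => f (c + t *: u))
  (fun t => 'D_u f (c + t *: u)) 0 h h0.
- by apply/is_derive_along_line/df; rewrite !ltW // (itvP xh).
- apply: derivable_within_continuous => x xh; apply: ex_derive.
  by apply/is_derive_along_line/df; rewrite !(itvP xh).
- by exists t; [rewrite !(itvP th)|move: E; rewrite scale0r addr0 subr0 mulrC].
Qed.

Lemma in_ball_plane (x u v : V) (t s h r : R) :
  0 <= t <= h -> 0 <= s <= h -> h * (`|u| + `|v|) < r ->
  ball x r (x + t *: u + s *: v).
Proof.
move=> /andP[t0 th] /andP[s0 sh] hr.
rewrite -ball_normE /ball_ /= -addrA opprD addrA subrr add0r normrN.
apply: le_lt_trans hr; apply: le_trans (ler_normD _ _) _.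
rewrite !normrZ !ger0_norm // mulrDr.
by apply: lerD; apply: ler_wpM2r.
Qed.

(** Two applications of the mean value theorem, first along [u] and then along
    [v]. The left-hand side is symmetric in [u] and [v], which is what
    [derive_swap] exploits. *)
Lemma second_difference (f : V -> R) (x u v : V) (h r : R) : 0 < h ->
  h * (`|u| + `|v|) < r -> (forall y, ball x r y -> differentiable f y) ->
  (forall y, ball x r y -> differentiable ('D_u f) y) ->
  exists2 y, ball x r y &
    f (x + h *: u + h *: v) - f (x + h *: u) - f (x + h *: v) + f x =
    h * (h * 'D_v ('D_u f) y).
Proof.
move=> h0 hr df dduf.
have inb t s : 0 <= t <= h -> 0 <= s <= h -> ball x r (x + t *: u + s *: v).
  by move=> th sh; exact: in_ball_plane hr.
have hh : 0 <= h <= h by rewrite lexx ltW.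
have h00 : 0 <= (0 : R) <= h by rewrite lexx ltW.
have inb0 t : 0 <= t <= h -> ball x r (x + t *: u).
  by move=> th; have := inb t 0 th h00; rewrite scale0r addr0.
pose F y := f (y + h *: v) - f y.
have dsh y : differentiable (fun z : V => z + h *: v) y.
  by apply: differentiableD.
have dF1 t : 0 <= t <= h ->
    differentiable (fun z => f (z + h *: v)) (x + t *: u).
  move=> th; apply: (@differentiable_comp _ _ _ _ (fun z : V => z + h *: v) f) => //.
  exact/df/inb.
have dF t : 0 <= t <= h -> differentiable F (x + t *: u).
  by move=> th; apply: differentiableB; [exact: dF1|exact/df/inb0].
have [t th E] := MVT_line h0 dF.
have th' : 0 <= t <= h by case/andP: th => *; rewrite !ltW.
have DF : 'D_u F (x + t *: u) =
    'D_u f (x + t *: u + h *: v) - 'D_u f (x + t *: u).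
  rewrite deriveB; last 2 first.
  - exact/diff_derivable/dF1.
  - exact/diff_derivable/df/inb0.
  rewrite (derive_comp u (dsh (x + t *: u)) (df _ (inb _ _ th' hh))).
  have [_] := is_deriveD (is_derive_id (x + t *: u) u) (is_derive_cst (h *: v) (x + t *: u) u).
  by rewrite addr0 => ->.
have [s sh E'] : exists2 s, 0 < s < h & 'D_u f (x + t *: u + h *: v) - 'D_u f (x + t *: u)
     = h * 'D_v ('D_u f) (x + t *: u + s *: v).
  apply: (@MVT_line ('D_u f) (x + t *: u) v h h0) => s sh.
  exact/dduf/inb.
have sh' : 0 <= s <= h by case/andP: sh => *; rewrite !ltW.
exists (x + t *: u + s *: v); first exact: inb.
by rewrite -E' -DF -E /F opprB addrA [RHS]addrAC.
Qed.

Lemma eq_of_near_coincidences (a b : V -> R) (x : V) :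
  {for x, continuous a} -> {for x, continuous b} ->
  (forall r, 0 < r -> exists y z, [/\ ball x r y, ball x r z & a y = b z]) ->
  a x = b x.
Proof.
move=> ca cb ab.
apply/eqP; rewrite -subr_eq0 -normr_le0; apply/ler_addgt0Pl => e e0; rewrite addr0.
have e20 : 0 < e / 2 by rewrite divr_gt0.
have /cvgrPdist_lt/(_ _ e20) c1 := ca; have /cvgrPdist_lt/(_ _ e20) c2 := cb.
have near_e : \forall y \near x, `|a x - a y| < e / 2 /\ `|b x - b y| < e / 2.
  exact: (filterI c1 c2).
have /nbhs_ballP[r /= r0 br] := near_e.
have [y [z [/br[y1 _] /br[_ z2] E]]] := ab r r0.
rewrite -(subrKA (a y)) {2}E [e]splitr.
apply: le_trans (ler_normD _ _) _; apply: lerD; first exact: ltW.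
by rewrite distrC ltW.
Qed.

(** Schwarz's theorem: both mixed derivatives are values of the same second
    difference, at points as close to [x] as desired. *)
Lemma derive_swap (U : set V) (f : V -> R) (u v : V) : open U -> class_C 2 U f ->
  forall x, U x -> 'D_u ('D_v f) x = 'D_v ('D_u f) x.
Proof.
move=> oU [df ddf] x Ux.
have [duf cuf] := ddf u; have [dvf cvf] := ddf v.
apply: (@eq_of_near_coincidences _ _ x (cvf u x Ux) (cuf v x Ux)) => r' r'0.
have rr : \forall y \near x, U y /\ ball x r' y.
  by apply: filterI (nbhsx_ballx _ _ r'0); exact: open_near.
have /nbhs_ballP[r /= r0 br] := rr.
(* small enough for the parallelogram of sides h u and h v to stay in the ball *)
pose h := r / (2 * (`|u| + `|v| + 1)).
have w0 : 0 < `|u| + `|v| + 1 by rewrite ltr_wpDl // addr_ge0.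
have h0 : 0 < h by rewrite divr_gt0 // mulr_gt0.
have hr : h * (`|u| + `|v|) < r.
  rewrite /h mulrAC ltr_pdivrMr ?mulr_gt0 // ltr_pM2l //.
  rewrite mulr_natl mulr2n ltr_wpDr ?ltW //.
  by rewrite ltrDl.
have hr' : h * (`|v| + `|u|) < r by rewrite [`|v| + _]addrC.
have dfb y : ball x r y -> differentiable f y by move=> /br[Uy _]; exact: df.
have [y by1 E1] := second_difference h0 hr dfb (fun z bz => duf z (br z bz).1).
have [z bz1 E2] := second_difference h0 hr' dfb (fun z bz => dvf z (br z bz).1).
have hn : h != 0 by rewrite gt_eqF.
have E : f (x + h *: u + h *: v) - f (x + h *: u) - f (x + h *: v) + f x =
         f (x + h *: v + h *: u) - f (x + h *: v) - f (x + h *: u) + f x.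
  by rewrite [x + h *: u + _]addrAC; congr (_ + _); rewrite [LHS]addrAC.
exists z, y; split; [exact: (br z bz1).2|exact: (br y by1).2|].
exact: mulfI hn _ _ (mulfI hn (etrans (esym E2) (etrans (esym E) E1))).
Qed.

Lemma local_max_derive (U : set V) (f : V -> R) (x u : V) :
  open U -> class_C 2 U f -> U x -> (forall y, U y -> f y <= f x) ->
  'D_u f x = 0 /\ 'D_u ('D_u f) x <= 0.
Proof.
move=> oU [df ddf] Ux fmax.
have [duf cuf] := ddf u.
have [r r0 br] : exists2 r, 0 < r & forall t, `|t| < r -> U (x + t *: u).
  have c : {for 0, continuous (fun s : R => x + s *: u)}.
    exact/differentiable_continuous/differentiable_line.
  have /nbhs_ballP[r /= r0 br] : \forall s \near 0, U (x + s *: u).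
    by apply: c; rewrite scale0r addr0; exact: open_near.
  by exists r => // t tr; apply: br; rewrite -ball_normE /ball_ /= sub0r normrN.
have itvr t : t \in `](-r), r[%R -> `|t| < r.
  by move=> tr; rewrite ltr_norml !(itvP tr).
have D0 : 'D_u f x = 0.
  have d0 : is_derive (0 : R) (1 : R) (fun s : R => f (x + s *: u)) 0.
    apply: (@derive1_at_max _ _ (-r) r).
    - by rewrite ge0_cp // ltW.
    - move=> t /itvr tr; have [] := is_derive_along_line (df _ (br _ tr)) => //.
    - by rewrite in_itv /= oppr_lt0 r0.
    - by move=> t /itvr tr; rewrite scale0r addr0; exact/fmax/br.
  have dl : differentiable f (x + (0 : R) *: u) by rewrite scale0r addr0; exact: df.
  have := @derive_val _ _ _ _ _ _ _ (is_derive_along_line dl).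
  by rewrite (@derive_val _ _ _ _ _ _ _ d0) scale0r addr0.
split=> //; rewrite leNgt; apply/negP => pos.
have [q q0 bq] : exists2 q, 0 < q & forall t, `|t| < q -> 0 < 'D_u ('D_u f) (x + t *: u).
  have c : {for 0, continuous (fun s : R => 'D_u ('D_u f) (x + s *: u))}.
    apply: (@continuous_comp _ _ _ (fun s : R => x + s *: u) ('D_u ('D_u f))).
      exact/differentiable_continuous/differentiable_line.
    by rewrite scale0r addr0; exact: cuf.
  have /nbhs_ballP[q /= q0 bq] : \forall s \near 0, 0 < 'D_u ('D_u f) (x + s *: u).
    apply: (c [set z : R | 0 < z]); rewrite scale0r addr0.
    exact: (lt_nbhsr pos).
  exists q; [exact: q0|move=> t tr; apply: (bq t)].
  by rewrite -ball_normE /ball_ /= sub0r normrN.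
pose h := Num.min r q / 2.
have m0 : 0 < Num.min r q by rewrite lt_min r0.
have h0 : 0 < h by rewrite divr_gt0.
have hm : h < Num.min r q by rewrite ltr_pdivrMr // ltr_pMr // ltr1n.
have hr t : 0 <= t <= h -> `|t| < r.
  move=> /andP[t0 th]; rewrite ger0_norm //; apply: le_lt_trans th _.
  by apply: lt_le_trans hm _; rewrite ge_min lexx.
have hq t : 0 <= t <= h -> `|t| < q.
  move=> /andP[t0 th]; rewrite ger0_norm //; apply: le_lt_trans th _.
  by apply: lt_le_trans hm _; rewrite ge_min lexx orbT.
have [t /andP[t0 th] E] := MVT_line h0 (fun t tr => df _ (br t (hr t tr))).
have [s /andP[s0 st] E'] : exists2 s, 0 < s < t & 'D_u f (x + t *: u) - 'D_u f x
     = t * 'D_u ('D_u f) (x + s *: u).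
  apply: (@MVT_line ('D_u f) x u t t0) => s /andP[s0 st]; apply/duf/br/hr.
  by rewrite s0 (le_trans st) // ltW.
have : f (x + h *: u) <= f x by apply/fmax/br/hr; rewrite lexx ltW.
rewrite -subr_le0 E leNgt => /negP; apply; apply: mulr_gt0 => //.
have sh : 0 <= s <= h by rewrite !ltW //; exact: lt_trans th.
by move: E'; rewrite D0 subr0 => ->; exact: (mulr_gt0 t0 (bq s (hq s sh))).
Qed.

End SecondDerivatives.

(** * Scalar products, orthonormal frames and smoothness of the connection *)

Section BilinearForm.
Variables (R : realType) (n : nat).
Implicit Types (A : 'M[R]_n) (u v w : 'rV[R]_n).

Lemma bilinDl A u v w : bilin A (u + v) w = bilin A u w + bilin A v w.
Proof. by rewrite /bilin !mulmxDl mxE. Qed.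

Lemma bilinDr A u v w : bilin A u (v + w) = bilin A u v + bilin A u w.
Proof. by rewrite /bilin linearD /= mulmxDr mxE. Qed.

Lemma bilinZl A c u v : bilin A (c *: u) v = c * bilin A u v.
Proof. by rewrite /bilin -!scalemxAl mxE. Qed.

Lemma bilinZr A c u v : bilin A u (c *: v) = c * bilin A u v.
Proof. by rewrite /bilin linearZ /= -scalemxAr mxE. Qed.

Lemma bilin0l A u : bilin A 0 u = 0.
Proof. by rewrite /bilin !mul0mx mxE. Qed.

Lemma bilin0r A u : bilin A u 0 = 0.
Proof. by rewrite /bilin linear0 mulmx0 mxE. Qed.

Lemma bilinNl A u v : bilin A (- u) v = - bilin A u v.
Proof. by rewrite -scaleN1r bilinZl mulN1r. Qed.

Lemma bilinNr A u v : bilin A u (- v) = - bilin A u v.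
Proof. by rewrite -scaleN1r bilinZr mulN1r. Qed.

Lemma bilinBl A u v w : bilin A (u - v) w = bilin A u w - bilin A v w.
Proof. by rewrite bilinDl bilinNl. Qed.

Lemma bilinBr A u v w : bilin A w (u - v) = bilin A w u - bilin A w v.
Proof. by rewrite bilinDr bilinNr. Qed.

Lemma bilin_suml I (r : seq I) P (F : I -> 'rV[R]_n) A v :
  bilin A (\sum_(i <- r | P i) F i) v = \sum_(i <- r | P i) bilin A (F i) v.
Proof.
apply: (big_morph (fun u => bilin A u v)); last exact: bilin0l.
by move=> x y; exact: bilinDl.
Qed.

Lemma bilin_sumr I (r : seq I) P (F : I -> 'rV[R]_n) A v :
  bilin A v (\sum_(i <- r | P i) F i) = \sum_(i <- r | P i) bilin A v (F i).
Proof.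
apply: (big_morph (bilin A v)); last exact: bilin0r.
by move=> x y; exact: bilinDr.
Qed.

Lemma bilinC A u v : A^T = A -> bilin A u v = bilin A v u.
Proof.
move=> sA; rewrite /bilin.
have -> : (u *m A *m v^T) 0 0 = (u *m A *m v^T)^T 0 0 by rewrite [RHS]mxE.
by rewrite !trmx_mul trmxK sA mulmxA.
Qed.

Definition posdef A := forall u, u != 0 -> 0 < bilin A u u.

Lemma posdef_ge0 A u : posdef A -> 0 <= bilin A u u.
Proof.
move=> pA; have [->|u0] := eqVneq u 0; first by rewrite bilin0l.
exact/ltW/pA.
Qed.

Lemma posdef_eq0 A u : posdef A -> bilin A u u = 0 -> u = 0.
Proof.
move=> pA; have [//|u0 /eqP] := eqVneq u 0.
by rewrite gt_eqF //; exact: pA.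
Qed.

Lemma posdef_nondegenerate A u : posdef A -> (forall v, bilin A u v = 0) -> u = 0.
Proof. by move=> pA /(_ u); exact: posdef_eq0. Qed.

Lemma posdef_unit A : posdef A -> A \in unitmx.
Proof.
move=> pA; rewrite -row_free_unit; apply/inj_row_free => v vA.
by apply: (posdef_nondegenerate pA) => w; rewrite /bilin vA mul0mx mxE.
Qed.

(** Written for the matrix with rows [e a], orthonormality is E A E^T = 1,
    whence A^-1 = E^T E. *)
Lemma invmx_orthonormal A (e : 'I_n -> 'rV[R]_n) :
  (forall a b, bilin A (e a) (e b) = (a == b)%:R) ->
  forall c d, invmx A c d = \sum_(a < n) e a 0 c * e a 0 d.
Proof.
move=> oe c d; pose E := \matrix_(a, b) e a 0 b.
have rE a : row a E = e a by apply/rowP => b; rewrite !mxE.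
have EA1 : E *m A *m E^T = 1%:M.
  apply/matrixP => a b; rewrite [RHS]mxE -oe -!rE /bilin.
  rewrite -row_mul tr_row !mxE; apply: eq_bigr => k _.
  by rewrite !mxE.
have EEA : E^T *m E *m A = 1%:M by rewrite -mulmxA; exact: mulmx1C.
have uA : A \in unitmx by case: (mulmx1_unit EEA).
have -> : invmx A = E^T *m E.
  by rewrite -[RHS](mulmxK uA) EEA mul1mx.
by rewrite mxE; apply: eq_bigr => a _; rewrite !mxE.
Qed.

End BilinearForm.

Section SmoothFields.
Variables (R : realType) (V : normedModType R) (U : set V).
Hypothesis U_open : open U.

Lemma class_C_scale n k (f : V -> R) (X : V -> 'rV[R]_n) :
  class_C k U f -> class_C k U X -> class_C k U (fun x => f x *: X x).
Proof.
move=> cf /(class_C_mxP U_open) cX; apply/(class_C_mxP U_open) => i j.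
apply: (class_C_eq U_open _ (class_CM U_open cf (cX i j))) => x _.
by rewrite mxE.
Qed.

Lemma class_CB n k (X Y : V -> 'rV[R]_n) :
  class_C k U X -> class_C k U Y -> class_C k U (fun x => X x - Y x).
Proof.
move=> cX cY; have c1 := class_C_cst U_open k (-1 : R).
apply: (class_C_eq U_open _ (class_CD U_open cX (class_C_scale c1 cY))) => x _.
by rewrite scaleN1r.
Qed.

Lemma class_C_bilin n k (G : V -> 'M[R]_n) (X Y : V -> 'rV[R]_n) :
  class_C k U G -> class_C k U X -> class_C k U Y ->
  class_C k U (fun x => bilin (G x) (X x) (Y x)).
Proof.
move=> /(class_C_mxP U_open) cG /(class_C_mxP U_open) cX /(class_C_mxP U_open) cY.
have H : class_C k U (fun x => \sum_(i < n) \sum_(j < n) G x i j * X x 0 i * Y x 0 j).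
  apply: class_C_sum => // i _; apply: class_C_sum => // j _.
  by apply: class_CM; last exact: cY; [|apply: class_CM; [|exact: cG|exact: cX]].
by apply: class_C_eq H => // x _; rewrite bilinE.
Qed.

End SmoothFields.

Section MetricOn.
Variables (R : realType) (n : nat).
Implicit Types (U : set 'rV[R]_n) (G : 'rV[R]_n -> 'M[R]_n).

Record metric_on U G : Prop := MetricOn {
  metric_on_open : open U;
  metric_on_smooth : smooth_on U G;
  metric_on_sym : forall x, U x -> (G x)^T = G x;
  metric_on_posdef : forall x, U x -> posdef (G x)
}.

(** Gram-Schmidt applied to the coordinate fields. Field [e a] has no component
    beyond [a], so the next orthogonal residue has component 1 along the next
    coordinate: it vanishes nowhere, and can be normalised smoothly. *)
Lemma gram_schmidt U G : metric_on U G ->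
  exists e : 'I_n -> 'rV[R]_n -> 'rV[R]_n, (forall a, smooth_on U (e a)) /\
    forall x, U x -> forall a b, bilin (G x) (e a x) (e b x) = (a == b)%:R.
Proof.
move=> [oU sG symG posG].
suff /(_ n (leqnn n)) [e [se oe _]] : forall k, (k <= n)%N ->
    exists e : 'I_n -> 'rV[R]_n -> 'rV[R]_n,
    [/\ forall a : 'I_n, (a < k)%N -> smooth_on U (e a),
        forall a b : 'I_n, (a < k)%N -> (b < k)%N -> forall x, U x ->
          bilin (G x) (e a x) (e b x) = (a == b)%:R &
        forall a c : 'I_n, (a < k)%N -> (k <= c)%N -> forall x, e a x 0 c = 0].
  by exists e; split=> [a|x Ux a b]; [exact: se|exact: oe].
elim=> [|k IH] kn; first by exists (fun _ _ => 0); split.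
have [e [se oe te]] := IH (ltnW kn).
pose q : 'I_n := Ordinal kn; pose b := basis_vector R q.
(* the residue of the next coordinate vector: its component along q is 1 *)
pose w x := b - \sum_(a < n | (a < k)%N) bilin (G x) b (e a x) *: e a x.
have sw : smooth_on U w.
  move=> l; apply: class_CB => //; first exact: class_C_cst.
  apply: class_C_sum => // a ak; apply: class_C_scale => //; last exact: se.
  by apply: class_C_bilin => //; [exact: class_C_cst|exact: se].
have w0 x : w x != 0.
  apply/eqP => /rowP /(_ q); rewrite !mxE !eqxx summxE big1 => [|a ak].
    by rewrite subr0 => /eqP; rewrite oner_eq0.
  by rewrite mxE te // mulr0.
have owe (a : 'I_n) x : (a < k)%N -> U x -> bilin (G x) (w x) (e a x) = 0.
  move=> ak Ux; rewrite bilinBl bilin_suml (bigD1 a) //= bilinZl oe // eqxx mulr1.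
  rewrite big1 ?addr0 ?subrr // => c /andP[ck ca].
  by rewrite bilinZl oe // (negbTE ca) mulr0.
pose N x := bilin (G x) (w x) (w x).
have N0 x : U x -> 0 < N x by move=> Ux; exact: posG.
pose e' (a : 'I_n) x := if (a < k)%N then e a x else (Num.sqrt (N x))^-1 *: w x.
have e'k (a : 'I_n) x : (a < k)%N -> e' a x = e a x by move=> ak; rewrite /e' ak.
have e'q x : e' q x = (Num.sqrt (N x))^-1 *: w x by rewrite /e' ltnn.
have case_k (a : 'I_n) : (a < k.+1)%N -> (a < k)%N \/ a = q.
  by rewrite ltnS leq_eqVlt => /orP[/eqP aq|]; [right; exact/val_inj|left].
exists e'; split.
- move=> a /case_k[ak|-> l].
    by rewrite (_ : e' a = e a); [exact: se|apply/funext => x; exact: e'k].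
  rewrite (_ : e' q = fun x => (Num.sqrt (N x))^-1 *: w x); last exact/funext.
  apply: class_C_scale => //; apply: class_CV => //.
    by move=> x Ux; rewrite sqrtr_eq0 -ltNge N0.
  by apply: class_C_sqrt => //; exact: class_C_bilin.
- have qk (a : 'I_n) : (a < k)%N -> (a == q) = false.
    by move=> ak; apply/eqP => aq; move: ak; rewrite aq /= ltnn.
  move=> a c /case_k[ak|->] /case_k[ck|->] x Ux.
  + by rewrite !e'k // oe.
  + by rewrite e'k // e'q bilinZr bilinC ?owe ?mulr0 ?qk // symG.
  + by rewrite (e'k _ _ ck) e'q bilinZl owe // mulr0 eq_sym qk.
  + rewrite e'q bilinZl bilinZr eqxx mulrA -invfM -expr2 sqr_sqrtr ?ltW ?N0 //.
    by rewrite mulVf // gt_eqF // N0.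
- move=> a c /case_k[ak|->] kc x; first by rewrite e'k // te // ltnW.
  rewrite e'q !mxE summxE big1 => [|d dk].
    have -> : (c == q) = false by apply/eqP => cq; move: kc; rewrite cq /= ltnn.
    by rewrite andbF subr0 mulr0.
  by rewrite mxE te ?mulr0 // ltnW.
Qed.

(** The inverse matrix of the metric is smooth because it is a polynomial in
    the components of a smooth orthonormal frame. *)
Lemma class_C_christoffel U G k l i j : metric_on U G ->
  class_C k U (fun x => christoffel G x l i j).
Proof.
move=> mG; have [e [se oe]] := gram_schmidt mG; case: mG => [oU sG symG posG].
have sGe a b : smooth_on U (fun x => G x a b).
  by move=> k'; apply: (proj1 (class_C_mxP oU _ _)); exact: sG.
have dGe a b v : class_C k U (fun x => 'D_v (fun y => G y a b) x).
  exact: (sGe a b k.+1).2.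
apply: class_CZ => //; apply: class_C_sum => // c _; apply: class_CM => //.
  have H : class_C k U (fun x => \sum_(a < n) e a x 0 l * e a x 0 c).
    apply: class_C_sum => // a _.
    by apply: class_CM => //; apply: (proj1 (class_C_mxP oU _ _)); exact: se.
  by apply: class_C_eq H => // x Ux; rewrite (invmx_orthonormal (oe x Ux)).
apply: class_CD => //; last by apply: class_CN.
exact: class_CD.
Qed.

End MetricOn.

Lemma class_C_christoffel_form (R : realType) (V : normedModType R) n k
    (U : set V) (U' : set 'rV[R]_n) (G : 'rV[R]_n -> 'M[R]_n)
    (f : V -> 'rV[R]_n) (X Y : V -> 'rV[R]_n) :
  open U -> metric_on U' G -> (forall x, U x -> U' (f x)) ->
  class_C k U f -> class_C k U X -> class_C k U Y ->
  class_C k U (fun x => christoffel_form G (f x) (X x) (Y x)).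
Proof.
move=> oU mG fU cf /(class_C_mxP oU) cX /(class_C_mxP oU) cY.
apply/(class_C_mxP oU) => i0 c.
have H : class_C k U (fun x => \sum_(i < n) \sum_(j < n)
    christoffel G (f x) c i j * X x 0 i * Y x 0 j).
  apply: class_C_sum => // i _; apply: class_C_sum => // j _.
  apply: class_CM => //; apply: class_CM => //.
  apply: (class_C_comp (g := fun y => christoffel G y c i j)) oU _ fU cf _.
    by case: mG.
  exact: (class_C_christoffel _ _ _ _ mG).
by apply: class_C_eq H => // x Ux; rewrite mxE.
Qed.

(** * Derivatives along vector fields and compatibility with the metric *)

Section Directions.
Variables (R : realType) (V W : normedModType R).

Lemma deriveD_dir (f : V -> W) x u v :
  differentiable f x -> 'D_(u + v) f x = 'D_u f x + 'D_v f x.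
Proof. by move=> df; rewrite !deriveE // linearD. Qed.

Lemma deriveZ_dir (f : V -> W) x c u :
  differentiable f x -> 'D_(c *: u) f x = c *: 'D_u f x.
Proof. by move=> df; rewrite !deriveE // linearZ. Qed.

Lemma deriveB_dir (f : V -> W) x u v :
  differentiable f x -> 'D_(u - v) f x = 'D_u f x - 'D_v f x.
Proof. by move=> df; rewrite !deriveE // linearB. Qed.

End Directions.

Section RowValued.
Variables (R : realType).

Lemma derive2_entry (V : normedModType R) p n (U : set V) (f : V -> 'M[R]_(p, n))
    u v x i k :
  open U -> class_C 2 U f -> U x ->
  ('D_u ('D_v f) x) i k = 'D_u ('D_v (fun z => f z i k)) x.
Proof.
move=> oU [df ddf] Ux; apply: etrans (derive_entry _ _ _ ((ddf v).1 x Ux)) _.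
by apply: (derive_eq_on oU _ _ Ux) => y Uy; exact/derive_entry/df.
Qed.

Lemma derive_swap_row (V : normedModType R) n (U : set V) (f : V -> 'rV[R]_n) u v x :
  open U -> class_C 2 U f -> U x -> 'D_u ('D_v f) x = 'D_v ('D_u f) x.
Proof.
move=> oU cf Ux; apply/rowP => k.
have ck : class_C 2 U (fun z => f z 0 k) by move/(class_C_mxP oU): cf; apply.
apply: etrans (derive2_entry u v 0 k oU cf Ux) _.
apply: etrans (derive_swap u v oU ck Ux) _.
exact: esym (derive2_entry v u 0 k oU cf Ux).
Qed.

(** The Leibniz rule for the pairing of the differential of [g] with a section
    along [f]. It separates the part that depends on the derivative of the
    section, which makes the second fundamental form tensorial. *)
Lemma derive_along_scalar (V : normedModType R) n (U' : set 'rV[R]_n)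
    (f xi : V -> 'rV[R]_n) (g : 'rV[R]_n -> R) x :
  open U' -> U' (f x) -> class_C 2 U' g -> differentiable f x ->
  differentiable xi x ->
  differentiable (fun y => 'D_(xi y) g (f y)) x /\
  forall u, 'D_u (fun y => 'D_(xi y) g (f y)) x =
    'D_('D_u xi x) g (f x) + 'D_('D_u f x) ('D_(xi x) g) (f x).
Proof.
move=> oU' U'x [dg ddg] df dxi.
have nU' : \forall y \near x, U' (f y).
  exact: near_preimage (differentiable_continuous df) oU' U'x.
pose F y := \sum_(c < n) (xi y 0 c * 'D_(basis_vector R c) g (f y)).
have nF : \forall y \near x, F y = 'D_(xi y) g (f y).
  by apply: filterS nU' => y U'y; rewrite (derive_dirE _ (dg _ U'y)).
have FE : F = \sum_(c < n) (fun y => xi y 0 c * 'D_(basis_vector R c) g (f y)).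
  by apply/funext => y; rewrite fct_sumE.
have dxic c : differentiable (fun y => xi y 0 c) x by exact: differentiable_entry.
have dgc c : differentiable (fun y => 'D_(basis_vector R c) g (f y)) x.
  exact: (differentiable_comp df ((ddg _).1 _ U'x)).
have dt c : differentiable (fun y => xi y 0 c * 'D_(basis_vector R c) g (f y)) x.
  exact: (differentiableM (dxic c) (dgc c)).
have dF : differentiable F x by rewrite FE; exact: differentiable_sum.
split; first exact: near_eq_differentiable nF dF.
move=> u; rewrite -(near_eq_derive u nF) FE derive_sum; last first.
  by move=> c; exact/diff_derivable/dt.
have E c : 'D_u (fun y => xi y 0 c * 'D_(basis_vector R c) g (f y)) x =
    xi x 0 c * 'D_('D_u f x) ('D_(basis_vector R c) g) (f x) +
    ('D_u xi x) 0 c * 'D_(basis_vector R c) g (f x).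
  rewrite (deriveM (diff_derivable (dxic c)) (diff_derivable (dgc c))).
  rewrite (derive_comp u df ((ddg _).1 _ U'x)) (derive_entry _ _ _ dxi).
  by congr (_ + _); rewrite /GRing.scale /= mulrC.
rewrite (eq_bigr _ (fun c _ => E c)) big_split /= addrC; congr (_ + _).
  by rewrite (derive_dirE _ (dg _ U'x)).
have H y : U' y -> 'D_(xi x) g y = \sum_(c < n) xi x 0 c * 'D_(basis_vector R c) g y.
  by move=> U'y; rewrite (derive_dirE _ (dg _ U'y)).
rewrite (derive_eq_on oU' _ H U'x).
have -> : (fun y => \sum_(c < n) xi x 0 c * 'D_(basis_vector R c) g y) =
    \sum_(c < n) (xi x 0 c *: 'D_(basis_vector R c) g).
  by apply/funext => y; rewrite fct_sumE.
have dd c : derivable ('D_(basis_vector R c) g) (f x) ('D_u f x).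
  exact/diff_derivable/((ddg _).1 _ U'x).
rewrite derive_sum => [|c]; last exact: derivableZ.
by apply: eq_bigr => c _; rewrite deriveZ.
Qed.

Lemma derive_along (V : normedModType R) n p (U' : set 'rV[R]_n)
    (f xi : V -> 'rV[R]_n) (g : 'rV[R]_n -> 'rV[R]_p) x :
  open U' -> U' (f x) -> class_C 2 U' g -> differentiable f x ->
  differentiable xi x ->
  differentiable (fun y => 'D_(xi y) g (f y)) x /\
  forall u, 'D_u (fun y => 'D_(xi y) g (f y)) x =
    'D_('D_u xi x) g (f x) + 'D_('D_u f x) ('D_(xi x) g) (f x).
Proof.
move=> oU' U'x cg df dxi; have [dg ddg] := cg.
have nU' : \forall y \near x, U' (f y).
  exact: near_preimage (differentiable_continuous df) oU' U'x.
have ck k : class_C 2 U' (fun z => g z 0 k) by move/(class_C_mxP oU'): cg; apply.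
have nk k : \forall y \near x, 'D_(xi y) (fun z => g z 0 k) (f y) = ('D_(xi y) g (f y)) 0 k.
  by apply: filterS nU' => y U'y; rewrite derive_entry //; exact: dg.
have S k := derive_along_scalar oU' U'x (ck k) df dxi.
have dS : differentiable (fun y => 'D_(xi y) g (f y)) x.
  apply: differentiable_mx => i k; rewrite ord1.
  exact: near_eq_differentiable (nk k) (S k).1.
split=> // u; apply/rowP => k.
rewrite (derive_entry _ _ _ dS) -(near_eq_derive u (nk k)) (S k).2 mxE.
rewrite (derive_entry _ _ _ (dg _ U'x)); congr (_ + _).
rewrite (derive_entry _ _ _ ((ddg _).1 _ U'x)).
apply: (derive_eq_on oU' _ _ U'x) => y U'y.
by rewrite (derive_entry _ _ _ (dg _ U'y)).
Qed.

Lemma derive_bilin (V : normedModType R) n (A : V -> 'M[R]_n)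
    (X Y : V -> 'rV[R]_n) x v :
  differentiable A x -> differentiable X x -> differentiable Y x ->
  'D_v (fun y => bilin (A y) (X y) (Y y)) x =
  bilin ('D_v A x) (X x) (Y x) + bilin (A x) ('D_v X x) (Y x) +
  bilin (A x) (X x) ('D_v Y x).
Proof.
move=> dA dX dY.
have DA i j : derivable (fun y => A y i j) x v.
  exact/diff_derivable/differentiable_entry.
have DX i j : derivable (fun y => X y i j) x v.
  exact/diff_derivable/differentiable_entry.
have DY i j : derivable (fun y => Y y i j) x v.
  exact/diff_derivable/differentiable_entry.
have Dt i j : is_derive x v (fun y => A y i j * X y 0 i * Y y 0 j)
    (A x i j * X x 0 i * 'D_v (fun y => Y y 0 j) x +
     Y x 0 j * (A x i j * 'D_v (fun y => X y 0 i) x +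
                X x 0 i * 'D_v (fun y => A y i j) x)).
  apply: is_deriveM; last exact: derivableP.
  by apply: is_deriveM; exact: derivableP.
have -> : (fun y => bilin (A y) (X y) (Y y)) =
   \sum_(i < n) \sum_(j < n) (fun y => A y i j * X y 0 i * Y y 0 j).
  apply/funext => y; rewrite bilinE fct_sumE; apply: eq_bigr => i _.
  by rewrite fct_sumE.
rewrite derive_val !bilinE -!big_split; apply: eq_bigr => i _ /=.
rewrite -!big_split; apply: eq_bigr => j _ /=.
rewrite !derive_entry //; ring.
Qed.

End RowValued.

Section Christoffel.
Variables (R : realType) (n : nat) (U : set 'rV[R]_n) (G : 'rV[R]_n -> 'M[R]_n).
Implicit Types u v w : 'rV[R]_n.

Lemma christoffel_formDl x u v w : christoffel_form G x (u + v) w =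
  christoffel_form G x u w + christoffel_form G x v w.
Proof.
apply/rowP => k; rewrite !mxE -big_split; apply: eq_bigr => i _ /=.
by rewrite -big_split; apply: eq_bigr => j _ /=; rewrite mxE; ring.
Qed.

Lemma christoffel_formZl x c u w : christoffel_form G x (c *: u) w =
  c *: christoffel_form G x u w.
Proof.
apply/rowP => k; rewrite !mxE mulr_sumr; apply: eq_bigr => i _ /=.
by rewrite mulr_sumr; apply: eq_bigr => j _ /=; rewrite mxE; ring.
Qed.

Hypothesis mG : metric_on U G.

Lemma metric_on_near_sym x : U x -> \near x, (G x)^T = G x.
Proof.
move=> Ux; apply: filterS (open_near (metric_on_open mG) Ux).
exact: metric_on_sym.
Qed.

Lemma christoffel_formC x u v : U x ->
  christoffel_form G x u v = christoffel_form G x v u.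
Proof.
move=> Ux; apply/rowP => k; rewrite !mxE exchange_big /=.
apply: eq_bigr => i _; apply: eq_bigr => j _.
rewrite christoffel_sym; last exact: metric_on_near_sym.
by rewrite mulrAC.
Qed.

Lemma metric_on_differentiable x : U x -> differentiable G x.
Proof. exact: (metric_on_smooth mG 1%N).1. Qed.

Lemma metric_on_unit x : U x -> G x \in unitmx.
Proof. by move=> Ux; exact/posdef_unit/(metric_on_posdef mG). Qed.

Lemma derive_metric x w u v : U x ->
  'D_w (fun y => bilin (G y) u v) x =
  bilin (G x) (christoffel_form G x w u) v + bilin (G x) u (christoffel_form G x w v).
Proof.
move=> Ux.
have := @nabla_metric R n G (cst w) (cst u) (cst v) x (metric_on_near_sym Ux)
  (metric_on_unit Ux) (metric_on_differentiable Ux)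
  (differentiable_cst _ _) (differentiable_cst _ _).
by rewrite /nabla /cst /= !derive_cst !add0r.
Qed.

End Christoffel.

(** The connection that [f] pulls back from that of [K], in the direction of a
    single tangent vector. *)
Definition covariant (R : realType) m n (K : 'rV[R]_n -> 'M[R]_n)
    (f : 'rV[R]_m -> 'rV[R]_n) (v : 'rV[R]_m) (xi : 'rV[R]_m -> 'rV[R]_n)
    (x : 'rV[R]_m) : 'rV[R]_n :=
  'D_v xi x + christoffel_form K (f x) ('D_v f x) (xi x).

(** Compatibility of the pulled back connection with the metric. The Leibniz
    rule leaves the derivative of the matrix [K] in the direction d f (v), which
    the Christoffel symbols of [K] absorb. *)
Lemma covariant_metric (R : realType) m n (U' : set 'rV[R]_n) K
    (f : 'rV[R]_m -> 'rV[R]_n) v (xi eta : 'rV[R]_m -> 'rV[R]_n) x :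
  metric_on U' K -> U' (f x) -> differentiable f x ->
  differentiable xi x -> differentiable eta x ->
  'D_v (fun y => bilin (K (f y)) (xi y) (eta y)) x =
  bilin (K (f x)) (covariant K f v xi x) (eta x) +
  bilin (K (f x)) (xi x) (covariant K f v eta x).
Proof.
move=> mK U'x df dxi deta.
have dK := metric_on_differentiable mK U'x.
rewrite (derive_bilin v (differentiable_comp df dK) dxi deta).
rewrite (derive_comp v df dK) /covariant bilinDl bilinDr.
have := derive_metric mK ('D_v f x) (xi x) (eta x) U'x.
rewrite (derive_bilin _ dK (differentiable_cst _ _) (differentiable_cst _ _)).
rewrite !derive_cst bilin0l bilin0r !addr0 => -> /=; ring.
Qed.

(** * The second fundamental form of an isometric immersion *)

Record local_isometry (R : realType) m n (U : set 'rV[R]_m) G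
    (U' : set 'rV[R]_n) K (f : 'rV[R]_m -> 'rV[R]_n) : Prop := LocalIsometry {
  isometry_source : metric_on U G;
  isometry_target : metric_on U' K;
  isometry_maps : forall x, U x -> U' (f x);
  isometry_smooth : smooth_on U f;
  isometry_metric : forall x, U x -> forall u v,
    bilin (G x) u v = bilin (K (f x)) ('D_u f x) ('D_v f x)
}.

(** The second fundamental form as a tensor: its value on two tangent vectors.
    It is the second fundamental form of vector fields extending them
    ([second_formE]). *)
Definition sff (R : realType) m n (G : 'rV[R]_m -> 'M[R]_m)
    (K : 'rV[R]_n -> 'M[R]_n) (f : 'rV[R]_m -> 'rV[R]_n) (x u v : 'rV[R]_m)
    : 'rV[R]_n :=
  covariant K f u ('D_v f) x - 'D_(christoffel_form G x u v) f x.

Section SecondFundamentalForm.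
Variables (R : realType) (m n : nat) (U : set 'rV[R]_m) (G : 'rV[R]_m -> 'M[R]_m).
Variables (U' : set 'rV[R]_n) (K : 'rV[R]_n -> 'M[R]_n) (f : 'rV[R]_m -> 'rV[R]_n).
Hypothesis fI : local_isometry U G U' K f.
Implicit Types u v w : 'rV[R]_m.

Let oU : open U := metric_on_open (isometry_source fI).

Lemma isometry_differentiable x : U x -> differentiable f x.
Proof. exact: (isometry_smooth fI 1%N).1. Qed.

Lemma isometry_differentiable_derive x v : U x -> differentiable ('D_v f) x.
Proof. exact: ((isometry_smooth fI 2%N).2 v).1. Qed.

Let df := isometry_differentiable.
Let ddf := isometry_differentiable_derive.

Lemma covariant_derive_sym x u v : U x ->
  covariant K f u ('D_v f) x = covariant K f v ('D_u f) x.
Proof.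
move=> Ux; have U'x := isometry_maps fI Ux.
exact: (congr2 +%R (derive_swap_row u v oU (isometry_smooth fI 2%N) Ux)
  (christoffel_formC (isometry_target fI) ('D_u f x) ('D_v f x) U'x)).
Qed.

Lemma sff_sym x u v : U x -> sff G K f x u v = sff G K f x v u.
Proof.
move=> Ux; rewrite /sff (covariant_derive_sym u v Ux).
by rewrite (christoffel_formC (isometry_source fI) u v Ux).
Qed.

Lemma sffDl x u v w : U x -> sff G K f x (u + v) w = sff G K f x u w + sff G K f x v w.
Proof.
move=> Ux; rewrite /sff /covariant (deriveD_dir _ _ (ddf w Ux)).
rewrite (deriveD_dir _ _ (df Ux)) !christoffel_formDl (deriveD_dir _ _ (df Ux)).
by rewrite addrACA opprD [RHS]addrACA.
Qed.

Lemma sffZl x c u w : U x -> sff G K f x (c *: u) w = c *: sff G K f x u w.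
Proof.
move=> Ux; rewrite /sff /covariant (deriveZ_dir _ _ (ddf w Ux)).
rewrite (deriveZ_dir _ _ (df Ux)) !christoffel_formZl (deriveZ_dir _ _ (df Ux)).
by rewrite -scalerDr -scalerBr.
Qed.

Lemma isometry_derive_eq0 x u : U x -> 'D_u f x = 0 -> u = 0.
Proof.
move=> Ux e; apply: (posdef_eq0 (metric_on_posdef (isometry_source fI) Ux)).
by rewrite (isometry_metric fI Ux) e bilin0l.
Qed.

(** The metric [G] being the pull-back of [K], its derivative can be computed
    with either connection; comparing both gives T(u,v,w) + T(u,w,v) = 0 for
    T(u,v,w) = <sff u v, df w>. As T is symmetric in its first two arguments,
    it vanishes, as in the proof that the Levi-Civita connection is unique. *)
Lemma sff_normal x u v w : U x ->
  bilin (K (f x)) (sff G K f x u v) ('D_w f x) = 0.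
Proof.
move=> Ux; pose T a b c := bilin (K (f x)) (sff G K f x a b) ('D_c f x).
have mG := isometry_source fI; have mK := isometry_target fI.
have U'x := isometry_maps fI Ux; have symK := metric_on_sym mK U'x.
have TE a b c : T a b c = bilin (K (f x)) (covariant K f a ('D_b f) x) ('D_c f x) -
    bilin (K (f x)) ('D_(christoffel_form G x a b) f x) ('D_c f x).
  exact: bilinBl.
have rearrange (p q r s : R) : p + q = r + s -> r - p = - (s - q).
  by move=> H; rewrite opprB -[q](addKr p) H; ring.
have skew a b c : T a b c = - T a c b.
  have E := derive_metric mG a b c Ux.
  have E' := covariant_metric a mK U'x (df Ux) (ddf b Ux) (ddf c Ux).
  have e y : U y -> bilin (G y) b c = bilin (K (f y)) ('D_b f y) ('D_c f y).
    by move=> Uy; exact: isometry_metric fI _ Uy _ _.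
  have := etrans (esym E) (etrans (derive_eq_on oU a e Ux) E').
  rewrite (isometry_metric fI Ux _ c) (isometry_metric fI Ux b _).
  rewrite (bilinC ('D_b f x) (covariant _ _ _ _ _) symK).
  rewrite (bilinC ('D_b f x) ('D_(christoffel_form G x a c) f x) symK) => H.
  by rewrite (TE a b c) (TE a c b); exact: rearrange H.
have sym a b c : T a b c = T b a c by rewrite /T sff_sym.
have : T u v w = - T u v w.
  by rewrite {1}skew sym skew opprK sym skew sym.
by move/eqP; rewrite -addr_eq0 -mulr2n mulrn_eq0 => /eqP.
Qed.

(** By the chain rule for second derivatives. The Christoffel terms of the
    middle metric [K] appear twice, with opposite signs. *)
Lemma sff_comp p (U'' : set 'rV[R]_p) L (g : 'rV[R]_n -> 'rV[R]_p) x u v :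
  local_isometry U' K U'' L g -> U x ->
  sff G L (g \o f) x u v =
  'D_(sff G K f x u v) g (f x) + sff K L g (f x) ('D_u f x) ('D_v f x).
Proof.
move=> gI Ux; have U'x := isometry_maps fI Ux.
have oU' := metric_on_open (isometry_target fI).
have [dg ddg] := isometry_smooth gI 2%N.
have e w y : U y -> 'D_w (g \o f) y = 'D_('D_w f y) g (f y).
  by move=> Uy; exact: derive_comp _ (df Uy) (dg _ (isometry_maps fI Uy)).
have [_ E] := derive_along oU' U'x (isometry_smooth gI 2%N) (df Ux) (ddf v Ux).
rewrite {1}/sff {1}/covariant (derive_eq_on oU u (e v) Ux) (E u) !(e _ x Ux) /=.
rewrite /sff (deriveB_dir _ _ (dg _ U'x)) /covariant (deriveD_dir _ _ (dg _ U'x)).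
have rearrange (a b c d k : 'rV[R]_p) : a + b + c - d = a + k - d + (b + c - k).
  by apply/rowP => l; rewrite !mxE; ring.
exact: rearrange.
Qed.

End SecondFundamentalForm.

(** Between spaces of equal dimension the differential of an isometric
    immersion is onto, so only zero is normal to its image. Applied to a change
    of charts, this is the transformation law of Christoffel symbols. *)
Lemma sff_eq_dim (R : realType) n (U U' : set 'rV[R]_n) G K (f : 'rV[R]_n -> 'rV[R]_n)
    x u v : local_isometry U G U' K f -> U x -> sff G K f x u v = 0.
Proof.
move=> fI Ux; have df := isometry_differentiable fI Ux.
pose J := \matrix_(c < n) 'D_(basis_vector R c) f x.
have JE w : w *m J = 'D_w f x.
  rewrite mulmx_sum_row (derive_dirE _ df); apply: eq_bigr => c _.
  by rewrite rowK.
have uJ : J \in unitmx.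
  rewrite -row_free_unit; apply/inj_row_free => w; rewrite JE.
  exact: (isometry_derive_eq0 fI).
have U'x := isometry_maps fI Ux.
apply: (posdef_eq0 (metric_on_posdef (isometry_target fI) U'x)).
have {2}-> : sff G K f x u v = 'D_(sff G K f x u v *m invmx J) f x.
  by rewrite -JE mulmxKV.
exact: sff_normal fI _ _ _ _ Ux.
Qed.

(** Both traces contract [B] with the inverse matrix of [A]. *)
Lemma orthonormal_trace (R : realType) n (W : lmodType R) (A : 'M[R]_n)
    (B : 'rV[R]_n -> 'rV[R]_n -> W) (e e' : 'I_n -> 'rV[R]_n) :
  (forall w, linear (B ^~ w)) -> (forall u, linear (B u)) ->
  (forall a b, bilin A (e a) (e b) = (a == b)%:R) ->
  (forall a b, bilin A (e' a) (e' b) = (a == b)%:R) ->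
  \sum_(a < n) B (e a) (e a) = \sum_(a < n) B (e' a) (e' a).
Proof.
move=> Bl Br.
have BE u w : B u w = \sum_(c < n) \sum_(d < n)
    (u 0 c * w 0 d) *: B (basis_vector R c) (basis_vector R d).
  pose bl z : {linear 'rV[R]_n -> W} :=
    HB.pack (B ^~ z) (GRing.isLinear.Build _ _ _ _ _ (Bl z)).
  pose br z : {linear 'rV[R]_n -> W} :=
    HB.pack (B z) (GRing.isLinear.Build _ _ _ _ _ (Br z)).
  rewrite -[B u w]/(bl w u) {1}[u]row_sum_delta linear_sum; apply: eq_bigr => c _.
  rewrite linearZ /= -[B _ w]/(br (delta_mx 0 c) w) {1}[w]row_sum_delta.
  rewrite linear_sum scaler_sumr; apply: eq_bigr => d _.
  by rewrite linearZ /= scalerA.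
suff tr (e0 : 'I_n -> 'rV[R]_n) : (forall a b, bilin A (e0 a) (e0 b) = (a == b)%:R) ->
    \sum_(a < n) B (e0 a) (e0 a) = \sum_(c < n) \sum_(d < n)
      invmx A c d *: B (basis_vector R c) (basis_vector R d).
  by move=> oe oe'; rewrite (tr _ oe) (tr _ oe').
move=> oe; under eq_bigr do rewrite BE.
rewrite exchange_big; apply: eq_bigr => c _ /=.
rewrite exchange_big; apply: eq_bigr => d _ /=.
by rewrite (invmx_orthonormal oe) scaler_suml.
Qed.

(** * The tension field in a chart *)

Section LocalSubmanifold.
Variables (R : realType) (m n : nat) (U : set 'rV[R]_m) (G : 'rV[R]_m -> 'M[R]_m).
Variables (U' : set 'rV[R]_n) (K : 'rV[R]_n -> 'M[R]_n) (f : 'rV[R]_m -> 'rV[R]_n).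
Hypothesis fI : local_isometry U G U' K f.
Implicit Types X Y e : 'rV[R]_m -> 'rV[R]_m.

Let oU : open U := metric_on_open (isometry_source fI).
Let mK := isometry_target fI.
Let df := isometry_differentiable fI.

Let sm_diff p (xi : 'rV[R]_m -> 'rV[R]_p) x : smooth_on U xi -> U x -> differentiable xi x.
Proof. by move=> sxi Ux; exact: (sxi 1%N).1. Qed.

Definition second_form X Y : 'rV[R]_m -> 'rV[R]_n :=
  fun x => nabla_pullback K f X (push f Y) x - push f (nabla G X Y) x.

Lemma smooth_push X : smooth_on U X -> smooth_on U (push f X).
Proof.
by move=> sX k; exact: class_C_derive_along_row oU (sX k) (isometry_smooth fI k.+1).
Qed.

Lemma smooth_nabla X Y : smooth_on U X -> smooth_on U Y -> smooth_on U (nabla G X Y).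
Proof.
move=> sX sY k; apply: class_CD => //.
  exact: class_C_derive_along_row oU (sX k) (sY k.+1).
exact: (class_C_christoffel_form (f := id) oU (isometry_source fI) (fun _ => id)
  (class_C_id oU k) (sX k) (sY k)).
Qed.

Lemma smooth_nabla_pullback X xi : smooth_on U X -> smooth_on U xi ->
  smooth_on U (nabla_pullback K f X xi).
Proof.
move=> sX sxi k; apply: class_CD => //.
  exact: class_C_derive_along_row oU (sX k) (sxi k.+1).
apply: (class_C_christoffel_form oU mK (isometry_maps fI) (isometry_smooth fI k)).
  exact: smooth_push.
exact: sxi.
Qed.

Lemma smooth_second_form X Y : smooth_on U X -> smooth_on U Y ->
  smooth_on U (second_form X Y).
Proof.
move=> sX sY k; apply: class_CB => //.
  by apply: smooth_nabla_pullback => //; exact: smooth_push.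
by apply: smooth_push; exact: smooth_nabla.
Qed.

Lemma second_formE X Y x : U x -> differentiable Y x ->
  second_form X Y x = sff G K f x (X x) (Y x).
Proof.
move=> Ux dY; rewrite /second_form /nabla_pullback /push /sff /covariant /nabla.
have [_ E] := derive_along (f := id) oU Ux (isometry_smooth fI 2%N)
  (@ex_diff _ _ _ _ _ _ _ (is_diff_id x)) dY.
rewrite (E (X x)) derive_id (deriveD_dir _ _ (df Ux)).
have rearrange (a b c d : 'rV[R]_n) : a + b + c - (a + d) = b + c - d.
  by apply/rowP => l; rewrite !mxE; ring.
exact: rearrange.
Qed.

Variable e : 'I_m -> 'rV[R]_m -> 'rV[R]_m.
Hypothesis se : forall a, smooth_on U (e a).

(** At a maximum of |tau|^2 the first derivatives vanish, so that e_a e_a |tau|^2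
    is the second derivative in the constant direction e_a(x), hence at most 0,
    and the term in nabla_{e_a} e_a contributes nothing. The Bochner formula
    then bounds the sum of the |nabla_{e_a} tau|^2 by zero. *)
Lemma energy_bochner (tau : 'rV[R]_m -> 'rV[R]_n) x : U x -> smooth_on U tau ->
  \sum_(a < m) (nabla_pullback K f (e a) (nabla_pullback K f (e a) tau) x
                - nabla_pullback K f (nabla G (e a) (e a)) tau x) = 0 ->
  (forall y, U y -> bilin (K (f y)) (tau y) (tau y) <=
                    bilin (K (f x)) (tau x) (tau x)) ->
  forall a, nabla_pullback K f (e a) tau x = 0.
Proof.
move=> Ux stau lap qmax.
pose q y := bilin (K (f y)) (tau y) (tau y).
have U'f := isometry_maps fI.
have symK y : U y -> (K (f y))^T = K (f y).
  by move=> Uy; exact: (metric_on_sym mK (U'f _ Uy)).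
have pos := metric_on_posdef mK (U'f _ Ux).
have cKf k : class_C k U (fun y => K (f y)).
  apply/(class_C_mxP oU) => i j.
  apply: (class_C_comp (g := fun z => K z i j)) oU (metric_on_open mK) U'f
    (isometry_smooth fI k) _.
  by move: (metric_on_smooth mK k) => /(class_C_mxP (metric_on_open mK)); apply.
have cq : class_C 2 U q by exact: (class_C_bilin oU (cKf 2%N) (stau 2%N) (stau 2%N)).
have Dq X y : U y -> 'D_(X y) q y = 2 * bilin (K (f y)) (nabla_pullback K f X tau y) (tau y).
  move=> Uy; have dt := sm_diff stau Uy.
  rewrite (covariant_metric (X y) mK (U'f _ Uy) (df Uy) dt dt).
  rewrite (bilinC (tau y) _ (symK _ Uy)).
  by rewrite -[covariant _ _ _ _ _]/(nabla_pullback K f X tau y); ring.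
have crit u : 'D_u q x = 0 /\ 'D_u ('D_u q) x <= 0.
  exact: local_max_derive oU cq Ux qmax.
have term a : bilin (K (f x)) (nabla_pullback K f (e a) (nabla_pullback K f (e a) tau) x
                - nabla_pullback K f (nabla G (e a) (e a)) tau x) (tau x) +
   bilin (K (f x)) (nabla_pullback K f (e a) tau x) (nabla_pullback K f (e a) tau x) <= 0.
  have z : bilin (K (f x)) (nabla_pullback K f (nabla G (e a) (e a)) tau x) (tau x) = 0.
    have := Dq (nabla G (e a) (e a)) x Ux; rewrite (crit _).1 => /esym/eqP.
    by rewrite mulf_eq0 pnatr_eq0 /= => /eqP.
  rewrite (etrans (bilinBl _ _ _ _) (etrans (congr1 (fun s => _ - s) z) (subr0 _))).
  have snt := smooth_nabla_pullback (se a) stau.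
  have E1 := covariant_metric (e a x) mK (U'f _ Ux) (df Ux) (sm_diff snt Ux) (sm_diff stau Ux).
  have [_ E2] := derive_along_scalar (f := id) oU Ux cq
    (@ex_diff _ _ _ _ _ _ _ (is_diff_id x)) (sm_diff (se a) Ux).
  have := E2 (e a x); rewrite derive_id (crit _).1 add0r.
  have e1 y : U y -> 'D_(e a y) q y =
      2 * bilin (K (f y)) (nabla_pullback K f (e a) tau y) (tau y).
    exact: Dq.
  rewrite (derive_eq_on oU (e a x) e1 Ux).
  have dd : differentiable (fun y => bilin (K (f y)) (nabla_pullback K f (e a) tau y) (tau y)) x.
    by have [+ _] := class_C_bilin oU (cKf 1%N) (snt 1%N) (stau 1%N); apply.
  rewrite (deriveMl _ (diff_derivable dd)) E1 => E.
  have := (crit (e a x)).2; rewrite -E pmulr_rle0 //.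
move=> a.
have tot : \sum_(a < m) bilin (K (f x)) (nabla_pullback K f (e a) tau x)
    (nabla_pullback K f (e a) tau x) = 0.
  apply/eqP; rewrite eq_le; apply/andP; split; last first.
    by apply: sumr_ge0 => b _; exact: posdef_ge0.
  have : \sum_(b < m) (bilin (K (f x)) (nabla_pullback K f (e b) (nabla_pullback K f (e b) tau) x
                - nabla_pullback K f (nabla G (e b) (e b)) tau x) (tau x) +
   bilin (K (f x)) (nabla_pullback K f (e b) tau x) (nabla_pullback K f (e b) tau x)) <= 0.
    by apply: sumr_le0 => b _; exact: term.
  by rewrite big_split /= -bilin_suml lap bilin0l add0r.
apply: (posdef_eq0 pos).
have := psumr_eq0P _ tot; apply => // b _; exact: posdef_ge0.
Qed.

Definition local_tension : 'rV[R]_m -> 'rV[R]_n :=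
  fun x => \sum_(a < m) second_form (e a) (e a) x.

Lemma smooth_local_tension : smooth_on U local_tension.
Proof.
by move=> k; apply: class_C_sum => // a _; exact: smooth_second_form.
Qed.

Lemma local_tension_normal x v : U x ->
  bilin (K (f x)) (local_tension x) ('D_v f x) = 0.
Proof.
move=> Ux; rewrite bilin_suml big1 // => a _.
rewrite second_formE //; last exact: sm_diff.
exact: (sff_normal fI _ _ _ Ux).
Qed.

(** Differentiating <tau, df e_a> = 0 along [e a] and summing over [a] yields
    |tau|^2 = - sum_a <nabla_(e a) tau, df e_a>. *)
Lemma parallel_tension_eq0 x : U x ->
  (forall a, nabla_pullback K f (e a) local_tension x = 0) -> local_tension x = 0.
Proof.
move=> Ux par; have U'x := isometry_maps fI Ux.
apply: (posdef_eq0 (metric_on_posdef mK U'x)).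
rewrite {2}/local_tension bilin_sumr big1 // => a _.
rewrite /second_form bilinBr local_tension_normal // subr0.
have E := covariant_metric (e a x) mK U'x (df Ux) (sm_diff smooth_local_tension Ux)
  (sm_diff (smooth_push (se a)) Ux).
have e0 y : U y -> bilin (K (f y)) (local_tension y) (push f (e a) y) = 0.
  by move=> Uy; exact: local_tension_normal.
move: E; rewrite (derive_eq_on (g := cst 0) oU (e a x) e0 Ux) derive_cst.
rewrite -[covariant K f (e a x) local_tension x]/(nabla_pullback K f (e a) local_tension x).
by rewrite par bilin0l add0r.
Qed.

End LocalSubmanifold.

Lemma sff_eq_on (R : realType) m n (U : set 'rV[R]_m) G K (f f' : 'rV[R]_m -> 'rV[R]_n)
    x u v : open U -> (forall y, U y -> f y = f' y) -> U x ->
  sff G K f x u v = sff G K f' x u v.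
Proof.
move=> oU ff' Ux; have E w y : U y -> 'D_w f y = 'D_w f' y.
  by move=> Uy; exact: (derive_eq_on oU w ff' Uy).
rewrite /sff /covariant (ff' x Ux) (derive_eq_on oU u (E v) Ux).
by rewrite (E u x Ux) (E v x Ux) (E _ x Ux).
Qed.

(** Both sides of psi o f = f2 o theta have the same second fundamental form.
    On the left it is d psi of that of [f], on the right it is that of [f2] at
    the images under d theta, since the second fundamental forms of [theta] and
    [psi] vanish; and d theta preserves orthonormal bases. *)
Lemma sff_trace_transition (R : realType) m n (U V : set 'rV[R]_m)
    (U' V' : set 'rV[R]_n) G K G2 K2 f f2 theta psi
    (e e2 : 'I_m -> 'rV[R]_m) x :
  local_isometry U G U' K f -> local_isometry V G2 V' K2 f2 ->
  local_isometry U G V G2 theta -> local_isometry U' K V' K2 psi ->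
  (forall y, U y -> psi (f y) = f2 (theta y)) -> U x ->
  (forall a b, bilin (G x) (e a) (e b) = (a == b)%:R) ->
  (forall a b, bilin (G2 (theta x)) (e2 a) (e2 b) = (a == b)%:R) ->
  \sum_(a < m) sff G2 K2 f2 (theta x) (e2 a) (e2 a) =
  'D_(\sum_(a < m) sff G K f x (e a) (e a)) psi (f x).
Proof.
move=> fI f2I thI psI com Ux oe oe2.
have oU := metric_on_open (isometry_source fI).
have Vx := isometry_maps thI Ux; have U'x := isometry_maps fI Ux.
have dps := isometry_differentiable psI U'x.
rewrite (deriveE _ dps) linear_sum.
have E u v : 'd psi (f x) (sff G K f x u v) =
    sff G2 K2 f2 (theta x) ('D_u theta x) ('D_v theta x).
  have := sff_comp fI u v psI Ux.
  rewrite (sff_eq_dim _ _ psI U'x) addr0 -(deriveE _ dps) => <-.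
  rewrite (@sff_eq_on _ _ _ U G K2 (psi \o f) (f2 \o theta) x u v oU com Ux).
  rewrite (sff_comp thI u v f2I Ux) (sff_eq_dim _ _ thI Ux).
  by rewrite derive0 add0r.
under [RHS]eq_bigr do rewrite E.
apply: (orthonormal_trace (A := G2 (theta x))) => //.
- by move=> w c u v; rewrite (sffDl f2I) // (sffZl f2I).
- move=> w c u v; rewrite ![sff _ _ _ _ w _](sff_sym f2I) //.
  by rewrite (sffDl f2I) // (sffZl f2I).
- by move=> a b; rewrite -(isometry_metric thI Ux).
Qed.

(** * The squared norm of the tension field on the manifold *)

Section ChartLemmas.
Variables (R : realType) (n : nat) (M : manifold R n) (g : riemannian_metric M).

Lemma param_coord (i : charts M) p : dom i p -> param i (coord i p) = p.
Proof. exact: chartK. Qed.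

Lemma transition_coord (i j : charts M) p : dom i p ->
  transition i j (coord i p) = coord j p.
Proof. by move=> ip; rewrite /transition /comp param_coord. Qed.

Lemma coord_continuous_at (i : charts M) p : dom i p -> {for p, continuous (coord i)}.
Proof.
move=> ip; have := @chart_continuous R n M (atlas M) i.
by rewrite continuous_open_subspace; [apply; exact/mem_set|exact: chart_dom_open].
Qed.

(** Within the open image of the chart, the image of [O] is the preimage of [O]
    under the continuous parametrisation. *)
Lemma coord_image_open (i : charts M) (O : set M) :
  open O -> O `<=` dom i -> open (coord i @` O).
Proof.
move=> oO Oi; have oC : open (chart_codom i) by exact: chart_codom_open.
have := @chart_inv_continuous R n M (atlas M) i.
rewrite continuous_open_subspace; last exact: oC.
move=> ci; rewrite openE => _ [p Op <-].
have Cp : chart_codom i (coord i p) by exists p; first exact: Oi.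
have cp : {for coord i p, continuous (param i)} by apply: ci; exact/mem_set.
have nO : \forall y \near coord i p, O (param i y).
  by apply: near_preimage cp oO _; rewrite param_coord //; exact: Oi.
rewrite /interior /=; apply: filterS (filterI (open_near oC Cp) nO).
by move=> _ [[q iq <-] Oq]; exists q => //; rewrite -(param_coord iq).
Qed.

Lemma metric_on_chart (i : charts M) U : open U -> U `<=` chart_codom i ->
  metric_on U (gram g i).
Proof.
move=> oU Ui; split=> // [k|x /Ui|x /Ui].
- exact: (class_C_subset Ui (@gram_smooth _ _ _ g i k)).
- exact: gram_sym.
- exact: gram_posdef.
Qed.

Lemma transition_isometry (i j : charts M) (O : set M) V :
  open O -> O `<=` dom i `&` dom j -> open V -> V `<=` chart_codom j ->
  (forall p, O p -> V (coord j p)) ->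
  local_isometry (coord i @` O) (gram g i) V (gram g j) (transition i j).
Proof.
move=> oO Oij oV Vj OV; have Oi : O `<=` dom i by move=> p /Oij[].
split.
- apply: metric_on_chart; first exact: coord_image_open.
  exact: image_subset.
- exact: metric_on_chart.
- by move=> _ [p Op <-]; rewrite (transition_coord _ (Oi _ Op)); exact: (OV p Op).
- move=> k; apply: class_C_subset (@transition_smooth _ _ _ (atlas M) i j k).
  exact: image_subset.
- move=> _ [p /Oij [ip jp] <-] u v.
  by rewrite (transition_coord _ ip); exact: metric_compat.
Qed.

End ChartLemmas.

Section Global.
Variables (R : realType) (m n : nat) (M : manifold R m) (N : manifold R n).
Variables (g : riemannian_metric M) (h : riemannian_metric N) (iota : M -> N).
Hypothesis iota_isometric : isometric_immersion g h iota.

Let iota_cont : continuous iota := iota_isometric.1.1.1.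

Lemma iota_preimage_open (j : charts N) (O : set N) :
  open O -> open (iota @^-1` O).
Proof. by move=> oO; apply: open_comp oO => x _; exact: iota_cont. Qed.

Lemma local_dom_open (i : charts M) (j : charts N) : open (local_dom iota i j).
Proof.
apply: coord_image_open; last by move=> p [].
apply: openI; first exact: chart_dom_open.
by apply: iota_preimage_open => //; exact: chart_dom_open.
Qed.

Lemma local_rep_coord (i : charts M) (j : charts N) p : dom i p ->
  local_rep iota i j (coord i p) = coord j (iota p).
Proof. by move=> ip; rewrite /local_rep /= param_coord. Qed.

Lemma local_rep_isometry (i : charts M) (j : charts N) U U' :
  open U -> U `<=` local_dom iota i j -> open U' -> U' `<=` chart_codom j ->
  (forall x, U x -> U' (local_rep iota i j x)) ->
  local_isometry U (gram g i) U' (gram h j) (local_rep iota i j).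
Proof.
move=> oU Uij oU' U'j UU'; have [[[_ sm] _] met] := iota_isometric.
split=> //.
- apply: metric_on_chart => // x /Uij [p [ip _] <-].
  by exists p.
- exact: metric_on_chart.
- by move=> k; exact: class_C_subset Uij (sm i j k).
- by move=> x /Uij; exact: met.
Qed.

Lemma local_dom_rep (i : charts M) (j : charts N) x :
  local_dom iota i j x -> chart_codom j (local_rep iota i j x).
Proof. by move=> [p [ip jp] <-]; rewrite local_rep_coord //; exists (iota p). Qed.

Lemma frame_isometry (i : charts M) (j : charts N) U e :
  orthonormal_frame g iota i j U e ->
  local_isometry U (gram g i) (chart_codom j) (gram h j) (local_rep iota i j).
Proof.
move=> [oU Uij _ _]; apply: local_rep_isometry => //.
  exact: chart_codom_open.
by move=> x /Uij; exact: local_dom_rep.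
Qed.

Lemma frame_dom (i : charts M) (j : charts N) U e x :
  orthonormal_frame g iota i j U e -> U x ->
  exists p, [/\ dom i p, dom j (iota p) & coord i p = x].
Proof. by move=> [_ Uij _ _] /Uij [p [ip jp] <-]; exists p. Qed.

Lemma orthonormal_frame_exists p : exists i j U e,
  [/\ orthonormal_frame g iota i j U e, dom i p & U (coord i p)].
Proof.
have [i ip] := chart_cover (atlas M) p; have [j jp] := chart_cover (atlas N) (iota p).
have oU := @local_dom_open i j.
have mU : metric_on (local_dom iota i j) (gram g i).
  by apply: metric_on_chart => // _ [q [iq _] <-]; exists q.
have [e [se oe]] := gram_schmidt mU.
by exists i, j, (local_dom iota i j), e; split; [split|exact: ip|exists p].
Qed.

Definition energy (i : charts M) (j : charts N) e x : R :=
  bilin (gram h j (local_rep iota i j x)) (tension g h iota i j e x)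
        (tension g h iota i j e x).

Lemma tension_sff (i : charts M) (j : charts N) U e x :
  orthonormal_frame g iota i j U e -> U x ->
  tension g h iota i j e x =
  \sum_(a < m) sff (gram g i) (gram h j) (local_rep iota i j) x (e a x) (e a x).
Proof.
move=> fr Ux; have fI := frame_isometry fr; case: fr => [oU Uij se oe].
apply: eq_bigr => a _.
exact: (second_formE fI (e a) Ux ((se a 1%N).1 x Ux)).
Qed.

(** The tension fields in the two charts of [N] are related by the differential
    of the change of charts, which is an isometry. *)
Lemma energy_indep (i i' : charts M) (j j' : charts N) U U' e e' p :
  orthonormal_frame g iota i j U e -> orthonormal_frame g iota i' j' U' e' ->
  dom i p -> dom i' p -> U (coord i p) -> U' (coord i' p) ->
  energy i j e (coord i p) = energy i' j' e' (coord i' p).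
Proof.
move=> fr fr' ip i'p Up U'p; rewrite /energy.
rewrite (tension_sff fr Up) (tension_sff fr' U'p).
have [oU Uij _ oe] := fr; have [oU' Uij' _ oe'] := fr'.
have jp : dom j (iota p).
  by have [q [iq jq /(congr1 (param i))]] := frame_dom fr Up; rewrite !param_coord // => <-.
have j'p : dom j' (iota p).
  by have [q [iq jq /(congr1 (param i'))]] := frame_dom fr' U'p; rewrite !param_coord // => <-.
pose B := dom j `&` dom j'.
have oB : open B by apply: openI; exact: chart_dom_open.
have oBj : open (coord j @` B) by apply: coord_image_open => // q [].
pose O := (dom i `&` dom i') `&` iota @^-1` B.
have oO : open O.
  by apply: openI; [apply: openI; exact: chart_dom_open|exact: iota_preimage_open].
have Op : O p by [].
pose W := coord i @` O; have Wp : W (coord i p) by exists p.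
have oW : open W by apply: coord_image_open => // q [[]].
have fI : local_isometry W (gram g i) (coord j @` B) (gram h j) (local_rep iota i j).
  apply: local_rep_isometry => //.
  - by move=> _ [q [[iq _] [jq _]] <-]; exists q.
  - by move=> _ [q [jq _] <-]; exists q.
  - by move=> _ [q [[iq _] Bq] <-]; rewrite local_rep_coord //; exists (iota q).
have fI' : local_isometry (local_dom iota i' j') (gram g i') (chart_codom j')
    (gram h j') (local_rep iota i' j').
  apply: local_rep_isometry => //; first exact: local_dom_open.
    exact: chart_codom_open.
  exact: local_dom_rep.
have thI : local_isometry W (gram g i) (local_dom iota i' j') (gram g i') (transition i i').
  apply: transition_isometry => //.
  - by move=> q [].
  - exact: local_dom_open.
  - by move=> _ [q [iq _] <-]; exists q.
  - by move=> q [[_ iq] [_ jq]]; exists q.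
have psI : local_isometry (coord j @` B) (gram h j) (chart_codom j') (gram h j')
    (transition j j').
  apply: transition_isometry => //; first exact: chart_codom_open.
  by move=> q [_ jq]; exists q.
have com y : W y -> transition j j' (local_rep iota i j y) =
    local_rep iota i' j' (transition i i' y).
  move=> [q [[iq i'q] [jq j'q]] <-].
  by rewrite local_rep_coord // !transition_coord // local_rep_coord.
have thp : transition i i' (coord i p) = coord i' p.
  exact: transition_coord.
have oe2 : forall a b, bilin (gram g i' (transition i i' (coord i p)))
    (e' a (coord i' p)) (e' b (coord i' p)) = (a == b)%:R.
  by move=> a b; rewrite thp oe'.
have := sff_trace_transition fI fI' thI psI com Wp (oe _ Up) oe2.
rewrite thp => tauE.
have := isometry_metric psI (isometry_maps fI Wp).
rewrite (com _ Wp) thp => psi_met.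
apply: etrans (psi_met _ _) _.
exact: (congr1 (fun t => bilin (gram h j' (local_rep iota i' j' (coord i' p))) t t)
  (esym tauE)).
Qed.

Lemma energy_continuous (i : charts M) (j : charts N) U e x :
  orthonormal_frame g iota i j U e -> U x -> {for x, continuous (energy i j e)}.
Proof.
move=> fr; have fI := frame_isometry fr; have [oU Uij se oe] := fr.
have mN := isometry_target fI.
have st := smooth_local_tension fI se.
move: x; rewrite -/(class_C 0 U (energy i j e)).
suff cK : class_C 0 U (fun x => gram h j (local_rep iota i j x)).
  exact: (class_C_bilin oU cK (st 0%N) (st 0%N)).
move=> x Ux; apply: (@continuous_comp _ _ _ (local_rep iota i j) (gram h j)).
  exact: (isometry_smooth fI 0%N).
exact: (metric_on_smooth mN 0%N) _ (isometry_maps fI Ux).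
Qed.

Lemma energy_global : exists2 F : M -> R, continuous F &
  forall i j U e p, orthonormal_frame g iota i j U e -> dom i p ->
    U (coord i p) -> F p = energy i j e (coord i p).
Proof.
have /choice [F FP] p : exists c, exists i j U e,
    [/\ orthonormal_frame g iota i j U e, dom i p, U (coord i p) &
        c = energy i j e (coord i p)].
  have [i [j [U [e [fr ip Up]]]]] := orthonormal_frame_exists p.
  by exists (energy i j e (coord i p)), i, j, U, e.
have FE i j U e p : orthonormal_frame g iota i j U e -> dom i p ->
    U (coord i p) -> F p = energy i j e (coord i p).
  move=> fr ip Up; have [i' [j' [U' [e' [fr' i'p U'p ->]]]]] := FP p.
  exact: energy_indep fr' fr _ _ _ _.
exists F => // p.
have [i [j [U [e [fr ip Up]]]]] := orthonormal_frame_exists p.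
have cip := coord_continuous_at ip; have [oU _ _ _] := fr.
have nd : \forall q \near p, dom i q.
  by apply: open_nbhs_nbhs; split=> //; exact: chart_dom_open.
have nF : \forall q \near p, energy i j e (coord i q) = F q.
  apply: filterS (filterI nd (near_preimage cip oU Up)) => q [iq Uq].
  by rewrite (FE _ _ _ _ _ fr iq Uq).
rewrite /continuous_at (FE _ _ _ _ _ fr ip Up).
apply: cvg_trans (near_eq_cvg nF) _.
exact: (continuous_comp cip (energy_continuous fr Up)).
Qed.

Lemma tension_mean_curvature (i : charts M) (j : charts N) e x :
  mean_curvature g h iota i j e x = m%:R^-1 *: tension g h iota i j e x.
Proof. by []. Qed.

(** * H-tensional and minimal submanifolds *)

Lemma H_tensional_minimal : compact [set: M] -> H_tensional g h iota -> minimal g h iota.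
Proof.
move=> M_compact Hten i0 j0 U0 e0 fr0 x0 U0x0.
have [F F_cont FE] := energy_global.
have [p0 [ip0 _ p0E]] := frame_dom fr0 U0x0.
have [p _ Fmax] : exists2 p, p \in [set: M] & forall q, q \in [set: M] -> F q <= F p.
  by apply: compact_EVT_max => //; [exists p0|exact: continuous_subspaceT].
have [i [j [U [e [fr ip Up]]]]] := orthonormal_frame_exists p.
have fI := frame_isometry fr; have [oU Uij se oe] := fr.
have tp0 : tension g h iota i j e (coord i p) = 0.
  apply: (parallel_tension_eq0 fI se Up).
  apply: (energy_bochner fI se Up (smooth_local_tension fI se)).
    have := Hten i j U e fr _ Up.
    by rewrite /rough_laplacian => /eqP; rewrite oppr_eq0 => /eqP.
  move=> y Uy; have [q [iq _ qE]] := frame_dom fr Uy.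
  move: Uy; rewrite -qE => Uq.
  have := Fmax q (mem_set I).
  by rewrite (FE _ _ _ _ _ fr iq Uq) (FE _ _ _ _ _ fr ip Up).
have Fp : F p = 0 by rewrite (FE _ _ _ _ _ fr ip Up) /energy tp0 bilin0l.
have fI0 := frame_isometry fr0.
have pos := metric_on_posdef (isometry_target fI0) (isometry_maps fI0 U0x0).
rewrite tension_mean_curvature (posdef_eq0 pos (u := tension g h iota i0 j0 e0 x0)) ?scaler0 //.
apply/eqP; rewrite eq_le posdef_ge0 // andbT.
have := Fmax p0 (mem_set I); rewrite Fp.
by move: U0x0; rewrite -p0E => U0p; rewrite (FE _ _ _ _ _ fr0 ip0 U0p).
Qed.

End Global.

Lemma nabla_pullback_eq0 (R : realType) m n (U : set 'rV[R]_m) (K : 'rV[R]_n -> 'M[R]_n)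
    (f : 'rV[R]_m -> 'rV[R]_n) X (xi : 'rV[R]_m -> 'rV[R]_n) :
  open U -> (forall x, U x -> xi x = 0) ->
  forall x, U x -> nabla_pullback K f X xi x = 0.
Proof.
move=> oU xi0 x Ux; rewrite /nabla_pullback (xi0 x Ux).
rewrite (derive_eq_on (g := cst 0) oU (X x) xi0 Ux) derive_cst add0r.
apply/rowP => k; rewrite !mxE big1 // => i _; rewrite big1 // => j _.
by rewrite mxE mulr0.
Qed.

Lemma minimal_H_tensional (R : realType) (m n : nat) (M : manifold R m)
    (N : manifold R n) (g : riemannian_metric M) (h : riemannian_metric N)
    (iota : M -> N) : minimal g h iota -> H_tensional g h iota.
Proof.
move=> mini i j U e fr x Ux; have [oU _ _ _] := fr.
have t0 y : U y -> tension g h iota i j e y = 0.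
  move=> Uy; have /eqP := mini i j U e fr y Uy.
  rewrite tension_mean_curvature scaler_eq0 => /orP[|/eqP //].
  (* when m = 0 the factor 1/m is 0, but the tension is an empty sum *)
  rewrite invr_eq0 pnatr_eq0 => /eqP m0.
  by rewrite /tension big1 // => a; move: (ltn_ord a); rewrite {2}m0.
rewrite /rough_laplacian big1 ?oppr0 // => a _.
rewrite !(nabla_pullback_eq0 _ _ _ oU) ?subrr // => y Uy.
exact: nabla_pullback_eq0 oU t0 _ Uy.
Qed.

Theorem theorem5p2 (R : realType) (m n : nat)
  (M : manifold R m) (g : riemannian_metric M)
  (N : manifold R n) (h : riemannian_metric N)
  (iota : M -> N)
  (M_connected : connected [set: M])
  (M_compact : compact [set: M])
  (iota_isometric : isometric_immersion g h iota) :
  H_tensional g h iota <-> minimal g h iota.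
Proof.
split; first exact: H_tensional_minimal.
exact: minimal_H_tensional.
Qed.
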